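(* Let $\Gamma$ be a distance-regular graph with vertex set $X$ and diameter $D\ge 3$, let $\{E_i\}_{i=0}^D$ be a $Q$-polynomial ordering of its primitive idempotents, let $x\in X$, and let $T^{\mathbb{R}}=T^{\mathbb{R}}(x)$ be the Terwilliger algebra of $\Gamma$ with respect to $x$ over $\mathbb{R}$. Then every irreducible $T^{\mathbb{R}}$-module $W$ is sharp; that is, $\dim_{\mathbb{R}}(E_r^*W)=1$, where $r$ is the endpoint of $W$.
   Context: $\Gamma$ is a finite, undirected, connected graph without loops or multiple edges, with vertex set $X$, path-length distance $\partial$ and diameter $D=\max\{\partial(y,z)\mid y,z\in X\}$. It is distance-regular: for all $0\le h,i,j\le D$ and all $y,z\in X$ with $\partial(y,z)=h$, the number $p^h_{i,j}=|\{w\in X\mid \partial(y,w)=i,\ \partial(z,w)=j\}|$ depends only on $h,i,j$. All matrices have rows and columns indexed by $X$. The adjacency matrix $A$ has $D+1$ distinct real eigenvalues $\theta_0,\dots,\theta_D$, with $\theta_0$ equal to the valency; the primitive idempotent $E_i$ is the matrix of the orthogonal projection onto the $\theta_i$-eigenspace of $A$. With $\circ$ the entrywise product, the Krein parameters $q^h_{i,j}$ are defined by $E_i\circ E_j=|X|^{-1}\sum_{h=0}^D q^h_{i,j}E_h$. The ordering $\{E_i\}_{i=0}^D$ is $Q$-polynomial if for all $0\le h,i,j\le D$: $q^h_{i,j}=0$ whenever one of $h,i,j$ is greater than the sum of the other two, and $q^h_{i,j}\ne0$ whenever one of $h,i,j$ equals the sum of the other two. For $0\le i\le D$, $E_i^*=E_i^*(x)$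 is the diagonal matrix with $(y,y)$-entry $1$ if $\partial(x,y)=i$ and $0$ otherwise. The Terwilliger algebra $T^{\mathbb{R}}$ is the subalgebra of the algebra $\mathrm{Mat}_X(\mathbb{R})$ of real matrices generated by $A$ and $E_0^*,\dots,E_D^*$. A $T^{\mathbb{R}}$-module is a subspace $W$ of $\mathbb{R}^X$ with $T^{\mathbb{R}}W\subseteq W$; it is irreducible if $W\ne0$ and it contains no $T^{\mathbb{R}}$-module other than $0$ and $W$. The endpoint of an irreducible module $W$ is $\min\{i\mid E_i^*W\neq 0\}$. *)

(* Defs.v *)
From HB Require Import structures.
From mathcomp Require Import all_boot all_order all_algebra.
From mathcomp Require Import reals.
Set Implicit Arguments.
Unset Strict Implicit.
Unset Printing Implicit Defensive.
Import Order.TTheory GRing.Theory Num.Theory.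
Local Open Scope ring_scope.

(* A graph on the finite vertex type X is given by its adjacency relation
   e : rel X.  Mat_X(R) is 'M[R]_#|X|, the k-th row or column standing for the
   vertex enum_val k, and R^X is the space 'cV[R]_#|X| of column vectors, on
   which matrices act by left multiplication. *)

Section Graph.
Variables (X : finType) (e : rel X).

Definition walk (n : nat) (y z : X) : bool :=
  [exists p : n.-tuple X, path e y p && (last y p == z)].

(* Length of a shortest path from y to z.  Such a path has fewer than #|X|
   edges; the junk value #|X| is taken when z is not reachable from y. *)
Definition dist (y z : X) : nat := find (fun n => walk n y z) (iota 0 #|X|).

Definition diameter : nat := \max_(y : X) \max_(z : X) dist y z.

Record distance_regular : Prop := DistanceRegular {
  drg_irreflexive : irreflexive e;
  drg_symmetric : symmetric e;
  drg_connected : forall y z : X, connect e y z;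
  drg_regular : forall h i j : nat,
    (h <= diameter)%N -> (i <= diameter)%N -> (j <= diameter)%N ->
    exists p : nat, forall y z : X, dist y z = h ->
      #|[set w | (dist y w == i) && (dist z w == j)]| = p }.

End Graph.

Section Matrices.
Variables (R : realType) (X : finType) (e : rel X).
Local Notation n := #|X|.
Local Notation D := (diameter e).

Definition adjmx : 'M[R]_n :=
  \matrix_(k, l) (e (enum_val k) (enum_val l))%:R.

Definition mxend (B : 'M[R]_n) : 'End('cV[R]_n) := linfun (@mulmx R n n 1 B).

Definition is_orthoproj (P : 'M[R]_n) (U : {vspace 'cV[R]_n}) : Prop :=
  (forall u, u \in U -> P *m u = u) /\
  (forall v : 'cV[R]_n,
     (forall u, u \in U -> u^T *m v = 0) -> P *m v = 0).

Definition eigenvalue_ordering (theta : 'I_D.+1 -> R) : Prop :=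
  [/\ injective theta,
      forall a : R, passmx.leigenvalue (mxend adjmx) a <-> exists i, theta i = a
    & forall y : X, theta ord0 = #|[set z | e y z]|%:R].

Definition idempotent_ordering (E : 'I_D.+1 -> 'M[R]_n) : Prop :=
  exists2 theta : 'I_D.+1 -> R, eigenvalue_ordering theta &
    forall i, is_orthoproj (E i) (passmx.leigenspace (mxend adjmx) (theta i)).

(* q h i j is q^h_{i,j}; the E h are linearly independent, so the equations
   below determine q. *)
Definition krein_parameters (E : 'I_D.+1 -> 'M[R]_n)
    (q : 'I_D.+1 -> 'I_D.+1 -> 'I_D.+1 -> R) : Prop :=
  forall i j, map2_mx *%R (E i) (E j) = n%:R^-1 *: \sum_h q h i j *: E h.

Definition Qpolynomial_ordering (E : 'I_D.+1 -> 'M[R]_n) : Prop :=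
  idempotent_ordering E /\
  exists2 q, krein_parameters E q &
    forall h i j : 'I_D.+1,
      ([|| h > i + j, i > h + j | j > h + i]%N -> q h i j = 0) /\
      ([|| h == i + j :> nat, i == h + j :> nat | j == h + i :> nat]%N ->
       q h i j != 0).

Variable x : X.

Definition Estar (i : nat) : 'M[R]_n :=
  diag_mx (\row_k (dist e x (enum_val k) == i)%:R).

Inductive terwilliger : 'M[R]_n -> Prop :=
| terwilliger_adj : terwilliger adjmx
| terwilliger_Estar i : (i <= D)%N -> terwilliger (Estar i)
| terwilliger_1 : terwilliger 1%:M
| terwilliger_add B C : terwilliger B -> terwilliger C -> terwilliger (B + C)
| terwilliger_scale (a : R) B : terwilliger B -> terwilliger (a *: B)
| terwilliger_mul B C : terwilliger B -> terwilliger C -> terwilliger (B *m C).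

Definition Tmodule (W : {vspace 'cV[R]_n}) : Prop :=
  forall B, terwilliger B -> forall w, w \in W -> B *m w \in W.

Definition irreducible_Tmodule (W : {vspace 'cV[R]_n}) : Prop :=
  [/\ Tmodule W, W != 0%VS &
      forall U : {vspace 'cV[R]_n}, Tmodule U -> (U <= W)%VS ->
        U = 0%VS \/ U = W].

Definition Estar_img (i : nat) (W : {vspace 'cV[R]_n}) : {vspace 'cV[R]_n} :=
  (mxend (Estar i) @: W)%VS.

(* The least i <= D with E_i^* W <> 0; it exists as soon as W <> 0. *)
Definition endpoint (W : {vspace 'cV[R]_n}) : nat :=
  find (fun i => Estar_img i W != 0%VS) (iota 0 D.+1).

Definition sharp (W : {vspace 'cV[R]_n}) : Prop :=
  \dim (Estar_img (endpoint W) W) = 1%N.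

End Matrices.

(* Main.v *)
Require Import Defs.
From HB Require Import structures.
From mathcomp Require Import all_boot all_order all_algebra.
From mathcomp Require Import boolp reals complex zify ring.
Set Implicit Arguments.
Unset Strict Implicit.
Unset Printing Implicit Defensive.
Import Order.TTheory GRing.Theory Num.Theory.
Local Open Scope ring_scope.

(** Let A^* be the diagonal matrix with entries (E_1)_{xy} (the dual adjacency
    matrix up to the factor |X|).  Write e_i for the action of E_i on W and f_j for
    that of E^*_{r+j}.  The Q-polynomial property and the triangle inequality say
    that e_i A^{*s} e_k = 0 and f_i A^s f_k = 0 for s < |i - k|.  Since A^* and A
    have distinct eigenvalues on the D+1 blocks, these are Vandermonde
    systems: in a word f_{x_0} e_{x_1} f_{x_2} ... the letters in any set of
    |x_{m-1} - x_{m+1}| values of position m can be eliminated in favour of the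
    other values.  Such eliminations rewrite every word into a combination of
    words whose indices spiral inwards (each x_{m+1} lies between x_{m-1} and x_m).
    A spiral that starts and ends with f_0 has only f_0 at its even positions, so
    f_0 T f_0 is generated by the elements f_0 e_i f_0.  The same elimination,
    applied to f_0 e_i f_j e_k f_0 - f_0 e_k f_j e_i f_0 by descending induction on j,
    shows that these generators commute.  Being symmetric real matrices, they have
    a common eigenvector u in E^*_r W; then f_0 T u is the line spanned by u,
    while T u = W by irreducibility. *)

(** * Elimination in Vandermonde systems *)

Definition lin_closed (F : pzRingType) (V : lmodType F) (P : V -> Prop) :=
  P 0 /\ forall a u v, P u -> P v -> P (a *: u + v).

Section LinClosed.
Variables (F : pzRingType) (V : lmodType F) (P : V -> Prop).
Hypothesis hP : lin_closed P.

Lemma lin_closedD u v : P u -> P v -> P (u + v).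
Proof. by move=> Pu Pv; rewrite -[u]scale1r; apply: hP.2. Qed.

Lemma lin_closedZ a u : P u -> P (a *: u).
Proof. by move=> Pu; rewrite -[_ *: _]addr0; apply: hP.2 => //; apply: hP.1. Qed.

Lemma lin_closed_sum (I : eqType) (r : seq I) (Q : pred I) (v : I -> V) :
  (forall i, i \in r -> Q i -> P (v i)) -> P (\sum_(i <- r | Q i) v i).
Proof.
move=> Pv; rewrite big_seq_cond; elim/big_ind: _; first exact: hP.1.
- exact: lin_closedD.
- by move=> i /andP[]; apply: Pv.
Qed.

End LinClosed.

Lemma eq0_lin_closed (F : pzRingType) (V : lmodType F) :
  lin_closed (fun v : V => v = 0).
Proof. by split=> // a u v -> ->; rewrite scaler0 addr0. Qed.

(** The polynomial [p] vanishes at [t j] for every [j] in [S] other than [i]. Its degree is below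
    [m], so the given relations combine to one with coefficients [p.[t j]], which expresses [v i] by
    the [v j] outside [S]. *)
Lemma elimination (F : fieldType) (V : lmodType F) (P : V -> Prop) (I : eqType)
    (r : seq I) (t : I -> F) (v : I -> V) (S : pred I) (m : nat) :
    lin_closed P -> uniq r -> {in r &, injective t} ->
    (forall s, (s < m)%N -> \sum_(i <- r) t i ^+ s *: v i = 0) ->
    (count S r <= m)%N ->
    (forall i, i \in r -> ~~ S i -> P (v i)) ->
  forall i, i \in r -> P (v i).
Proof.
move=> hP Ur injt rel cS PS i ir.
have [Si|] := boolP (S i); last exact: PS.
pose p := \prod_(j <- [seq j <- r | S j && (j != i)]) ('X - (t j)%:P).
have szp : (size p <= m)%N.
  rewrite /p size_prod_XsubC size_filter.
  apply: leq_trans cS; have /permP rE := perm_to_rem ir.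
  rewrite !rE /= Si eqxx /= add0n add1n ltnS; apply: sub_count => j /=.
  by case/andP.
have pti : p.[t i] != 0.
  rewrite /p horner_prod prodf_seq_neq0; apply/allP => j.
  rewrite mem_filter => /andP[/andP[_ ji] jr] /=.
  rewrite !hornerE subr_eq0; apply: contra_neq ji => /esym; exact: injt.
have sum0 : \sum_(j <- r) p.[t j] *: v j = 0.
  transitivity (\sum_(j <- r) \sum_(s < m) p`_s *: (t j ^+ s *: v j)).
    apply: eq_bigr => j _; rewrite (horner_coef_wide _ szp) scaler_suml.
    by apply: eq_bigr => s _; rewrite scalerA.
  rewrite exchange_big big1 // => s _.
  by rewrite -scaler_sumr rel ?scaler0 ?ltn_ord.
move: sum0; rewrite (bigD1_seq i) //= => /(canRL (addrK _)).
rewrite sub0r => /(congr1 (fun w => (p.[t i])^-1 *: w)).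
rewrite scalerA mulVf // scale1r => ->.
apply: lin_closedZ => //; rewrite -scaleN1r; apply: lin_closedZ => //.
apply: lin_closed_sum => // j jr ji.
have [Sj|nSj] := boolP (S j); last by apply: lin_closedZ => //; exact: PS.
suff -> : p.[t j] = 0 by rewrite scale0r; apply: hP.1.
rewrite /p horner_prod; apply/eqP; rewrite prodf_seq_eq0; apply/hasP.
by exists j; rewrite ?mem_filter ?Sj ?ji //= !hornerE subrr.
Qed.

(** * Words and inward spirals *)

(* A word with letters at positions 0..N is coded by x : nat -> int, where x h is
   the index of the letter at an odd position h and the opposite of that index at
   an even one.  With this sign convention moving outwards always means increasing
   x h, and the two parities need no separate treatment.  Q x is to be read as
   "the word x lies in the given subspace". *)
Section Spirals.
Variables (N d : nat) (Q : (nat -> int) -> Prop).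

Definition upd (x : nat -> int) (m : nat) (j : int) : nat -> int :=
  fun h => if h == m then j else x h.

Hypothesis Q_ext : forall x y : nat -> int, (forall h, (h <= N)%N -> x h = y h) -> Q x -> Q y.
Hypothesis Q_max : forall (x : nat -> int) h, (h <= N)%N -> d%:Z < x h -> Q x.
Hypothesis Q_odd : forall (x : nat -> int) h, (h <= N)%N -> odd h -> x h < 0 -> Q x.
Hypothesis Q_even : forall (x : nat -> int) h, (h <= N)%N -> ~~ odd h -> 0 < x h -> Q x.
(** This is [elimination] at position [m.+1]: at most |x_m - x_{m+2}| consecutive codes, from [a] up
    to but excluding [c], are traded for all the others. *)
Hypothesis Q_var : forall (x : nat -> int) m (a c : int), (m.+2 <= N)%N ->
  c - a <= `|x m - x m.+2| ->
  (forall j : int, j < a \/ c <= j -> Q (upd x m.+1 j)) -> Q x.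
Hypothesis Q_spiral : forall x : nat -> int,
  (forall h, (h <= N)%N -> ~~ odd h -> x h = 0) -> Q x.

(* Every word that is lexicographically further out than x, with first difference
   before position h, satisfies Q. *)
Definition dominated (h : nat) (x : nat -> int) :=
  forall h' x', (h' < h)%N -> (forall l, (l < h')%N -> x' l = x l) ->
    x h' < x' h' -> x' N = x N -> Q x'.

Lemma dominated_eq h h' x y : (h' <= h)%N ->
  (forall l, (l < h')%N -> y l = x l) -> y N = x N ->
  dominated h x -> dominated h' y.
Proof.
move=> hh xy xyN dom k z kh zy lt zN; apply: (dom k) => //.
- exact: leq_trans hh.
- by move=> l lk; rewrite zy // xy // (ltn_trans lk).
- by rewrite -xy.
- by rewrite zN.
Qed.

(** At the first crossing, eliminating the letter before it either pushes that letter outwards,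
    which [dominated] covers, or moves the crossing one position to the left. A crossing at the very
    start is a negative index. *)
Lemma Q_escape m x : (m < N)%N -> x 0%N = 0 ->
  (forall l, (l < m)%N -> 0 <= x l + x l.+1) -> x m + x m.+1 < 0 ->
  dominated m.+1 x -> Q x.
Proof.
elim: m x => [|m IHm] x mN x0 xs lt dom.
  by apply: (@Q_odd _ 1%N) => //; lia.
have xm := xs m (ltnSn m).
apply: (@Q_var x m (- x m) (- x m.+2)) => //; first by lia.
move=> j hj; set y := upd x m.+1 j.
have yle h : (h <= m)%N -> y h = x h by move=> hm; rewrite /y /upd ltn_eqF.
have ym : y m.+1 = j by rewrite /y /upd eqxx.
have yN : y N = x N by rewrite /y /upd gtn_eqF.
rewrite -/y; clearbody y; case: hj => hj; last by apply: (dom m.+1) => //; lia.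
apply: IHm; rewrite ?(yle 0%N) ?(yle m) ?ym //.
- exact: ltnW.
- by move=> l lm; rewrite !yle //; [apply: xs; lia|lia].
- by lia.
- by apply: dominated_eq dom => // l lm; rewrite yle.
Qed.

(* In the square of values of two adjacent letters, alternate between columns
   and rows: each determination shrinks the next line by one entry. *)
Lemma Q_square x m : (m.+3 <= N)%N ->
  (forall j k, [\/ j < - x m, x m.+3 <= j, k < - x m.+3 | x m < k] ->
     Q (upd (upd x m.+1 j) m.+2 k)) -> Q x.
Proof.
move=> mN hQ.
set y := fun j k => upd (upd x m.+1 j) m.+2 k.
have ym j k : y j k m = x m by rewrite /y /upd !ltn_eqF.
have y1 j k : y j k m.+1 = j by rewrite /y /upd eqxx ltn_eqF.
have y2 j k : y j k m.+2 = k by rewrite /y /upd eqxx.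
have y3 j k : y j k m.+3 = x m.+3 by rewrite /y /upd !gtn_eqF.
have upd1 j k j' : Q (y j' k) -> Q (upd (y j k) m.+1 j').
  by apply: Q_ext => h _; rewrite /y /upd; case: (eqVneq h m.+1) => // ->; rewrite ltn_eqF.
have upd2 j k k' : Q (y j k') -> Q (upd (y j k) m.+2 k').
  by apply: Q_ext => h _; rewrite /y /upd; case: (eqVneq h m.+2).
(* After [s] rounds the [s] lowest rows and columns are known. Both eliminated intervals have length
   x_m + x_{m+3} - s, the row skipping the entry supplied by [col]. *)
have stage (s : nat) : forall j k,
    [\/ j < s%:Z - x m, x m.+3 <= j, k < s%:Z - x m.+3 | x m < k] -> Q (y j k).
  elim: s => [|s IHs] j k; first by rewrite !sub0r; apply: hQ.
  have col j' : Q (y j' (s%:Z - x m.+3)).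
    apply: (@Q_var _ m (s%:Z - x m) (x m.+3)); first exact: ltnW.
      by rewrite ym y2; lia.
    move=> i [ilt|ige]; apply: upd1; apply: IHs.
      by apply: Or41.
    exact: Or42.
  have row k' : Q (y (s%:Z - x m) k').
    apply: (@Q_var _ m.+1 (s.+1%:Z - x m.+3) (x m + 1)) => //.
      by rewrite y1 y3; lia.
    move=> i [ilt|ige]; apply: upd2; last by apply: IHs; apply: Or44; lia.
    have [->|ne] := eqVneq i (s%:Z - x m.+3); first exact: col.
    by apply: IHs; apply: Or43; lia.
  case=> [jlt|jge|klt|kge].
  - have [->|ne] := eqVneq j (s%:Z - x m); first exact: row.
    by apply: IHs; apply: Or41; lia.
  - by apply: IHs; apply: Or42.
  - have [->|ne] := eqVneq k (s%:Z - x m.+3); first exact: col.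
    by apply: IHs; apply: Or43; lia.
  - by apply: IHs; apply: Or44.
apply: (@Q_ext (y (x m.+1) (x m.+2))).
  by move=> h _; rewrite /y /upd; case: eqP => [->|_] //; case: eqP => [->|].
(* Enough rounds for [x m.+1] to lie below [s%:Z - x m]. *)
apply: (stage (`|x m| + `|x m.+1|).+1%N); apply: Or41; lia.
Qed.

(** At the first letter lying further out than the one two positions before, [Q_square] replaces the
    two letters preceding it. What results is a crossing, a word further out, or an outward step one
    position earlier; at the start such a step is a negative index. *)
Lemma Q_backtrack m x : (m.+2 <= N)%N -> x 0%N = 0 ->
  (forall l, (l < m.+1)%N -> 0 <= x l + x l.+1) ->
  (forall l, (l.+2 <= m.+1)%N -> x l.+2 <= x l) ->
  x m < x m.+2 -> dominated m.+1 x -> Q x.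
Proof.
elim: m x => [|m IHm] x mN x0 xs xd lt dom.
  by apply: (@Q_even _ 2%N) => //; lia.
apply: (@Q_square x m) => // j k hjk.
have := xs m (ltnW (ltnSn _)); have := xs m.+1 (ltnSn _) => xs1 xs0.
set y := upd _ _ _.
have yle h : (h <= m)%N -> y h = x h by move=> hm; rewrite /y /upd !ltn_eqF // ltnW.
have ym1 : y m.+1 = j by rewrite /y /upd eqxx ltn_eqF.
have ym2 : y m.+2 = k by rewrite /y /upd eqxx.
have yN : y N = x N by rewrite /y /upd !gtn_eqF //; exact: ltnW.
clearbody y.
have esc z : (forall h, (h <= m)%N -> z h = x h) -> z N = x N ->
    z m.+1 < - x m -> Q z.
  move=> zle zN zm1; apply: (@Q_escape m); rewrite ?(zle 0%N) ?(zle m) //.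
  - by lia.
  - by move=> l lm; rewrite !zle //; [apply: xs; lia|lia].
  - by lia.
  - by apply: (@dominated_eq m.+2 m.+1 x) => // l lm; rewrite zle.
have better z : (forall h, (h <= m)%N -> z h = x h) -> z N = x N ->
    x m.+1 < z m.+1 -> Q z.
  by move=> zle zN zm1; apply: (dom m.+1).
have [jgt|jle] := ltrP (x m.+1) j; first by apply: better; rewrite ?ym1.
have [jlt|jge] := ltrP j (- x m); first by apply: esc; rewrite ?ym1.
case: hjk => [||klt|kgt]; [lia|lia| |].
  (* One more elimination of the letter at [m.+1] makes it either cross [x m] or move outwards past
     [x m.+3]. *)
  apply: (@Q_var _ m (- x m) (- k)); first by lia.
    by rewrite yle // ym2; lia.
  move=> i hi.
  have ule h : (h <= m)%N -> upd y m.+1 i h = x h.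
    by move=> hm; rewrite /upd ltn_eqF // yle.
  have uN : upd y m.+1 i N = x N by rewrite /upd gtn_eqF // ltnW.
  have u1 : upd y m.+1 i m.+1 = i by rewrite /upd eqxx.
  case: hi => hi; first by apply: esc; rewrite ?u1.
  by apply: better => //; rewrite u1; lia.
apply: IHm; rewrite ?(yle 0%N) ?(yle m) ?ym2 //.
- exact: ltnW.
- move=> l; rewrite ltnS leq_eqVlt => /orP[/eqP ->|lm].
    by rewrite ym1 yle //; lia.
  by rewrite !yle ?(ltnW lm) //; apply: xs; lia.
- move=> l; rewrite ltnS leq_eqVlt => /orP[/eqP e|lm].
    by rewrite e ym1 yle; [have := xd l; rewrite e; lia|lia].
  by rewrite !yle; [apply: xd; lia|lia|lia].
- by apply: (@dominated_eq m.+2 m.+1 x) => // l lm; rewrite yle.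
Qed.

(** A word without crossings or outward steps is an inward spiral: its entries at even positions
    decrease from [x 0 = 0] to [x N = 0], so they all vanish and [Q_spiral] applies. *)
Lemma Q_dominated x : ~~ odd N -> x 0%N = 0 -> x N = 0 ->
  dominated N.+1 x -> Q x.
Proof.
move=> oN x0 xN dom.
have domle h : (h <= N)%N -> dominated h.+1 x.
  by move=> hN; apply: dominated_eq dom.
have [//|[xs xd]] : Q x \/ (forall l, (l < N)%N -> 0 <= x l + x l.+1) /\
    (forall l, (l.+2 <= N)%N -> x l.+2 <= x l).
  move: (leqnn N); move: {1 3 4}N => k; elim: k => [|k IHk] kN; first by right.
  case: (IHk (ltnW kN)) => [Qx|[xs xd]]; first by left.
  have [lt|ge] := ltrP (x k + x k.+1) 0.
    by left; apply: (@Q_escape k) => //; apply: domle; exact: ltnW.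
  have xs' l : (l < k.+1)%N -> 0 <= x l + x l.+1.
    by rewrite ltnS leq_eqVlt => /orP[/eqP ->|/xs].
  case: k {IHk} kN xs xd ge xs' => [|k] kN xs xd ge xs'; first by right.
  have [lt|le] := ltrP (x k) (x k.+2).
    left; apply: (@Q_backtrack k) => //; apply: domle; lia.
  right; split=> // l; rewrite !ltnS leq_eqVlt => /orP[/eqP ->//|/xd //].
apply: Q_spiral => h hN oh.
have xle k : (k.*2 <= N)%N -> x k.*2 <= 0 by elim: k => [|k IHk] kN; [rewrite x0|
   rewrite doubleS in kN *; apply: le_trans (xd _ kN) (IHk _); lia].
have xge k : (k.*2 <= N)%N -> 0 <= x (N - k.*2)%N.
  elim: k => [|k IHk] kN; first by rewrite subn0 xN.
  have := xd (N - k.+1.*2)%N; have -> : ((N - k.+1.*2).+2 = N - k.*2)%N by lia.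
  have := IHk; lia.
have := xge (N./2 - h./2)%N; have := xle h./2.
have -> : (N - (N./2 - h./2).*2 = h)%N by lia.
have -> : (h./2.*2 = h)%N by lia.
by lia.
Qed.

(** Induction along the lexicographic order, outermost words first: domination is extended from
    prefixes of length [h] to length [h.+1], starting from the vacuous [dominated 0]. *)
Lemma Q_closed_word x : ~~ odd N -> x 0%N = 0 -> x N = 0 -> Q x.
Proof.
move=> oN; suff lex k : (k <= N.+1)%N -> forall y, y 0%N = 0 -> y N = 0 ->
    dominated (N.+1 - k) y -> Q y.
  move=> x0 xN; apply: (lex N.+1) => //; rewrite subnn => h; lia.
elim: k => [|k IHk] kN y y0 yN dom.
  by rewrite subn0 in dom; apply: Q_dominated.
set h := (N.+1 - k.+1)%N in dom.
have hN : (h <= N)%N by rewrite /h; lia.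
(* Outward moves at position [h] terminate, because codes above [d] are settled by [Q_max]. *)
have [v] := ubnP (absz (d%:Z + 1 - y h)%R); elim: v => // v IHv in y y0 yN dom * => hv.
have [dlt|dge] := ltrP d%:Z (y h); first exact: Q_max dlt.
apply: IHk => //; first exact: ltnW.
have -> : (N.+1 - k = h.+1)%N by rewrite /h; lia.
move=> h' z; rewrite ltnS leq_eqVlt => /orP[/eqP ->|h'h] zy lt zN; last first.
  exact: (dom h' z h'h zy lt zN).
have [h0|hpos] := posnP h.
  by apply: (@Q_even _ h) => //; rewrite h0 // -y0 -{1}h0 -h0.
have [zlt|zle] := ltrP d%:Z (z h); first exact: Q_max zlt.
by apply: IHv; rewrite ?(zy 0%N) ?zN //; [apply: (@dominated_eq h h y)|lia].
Qed.

End Spirals.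

(** * Words in two families of matrices *)

Lemma count_interval (r : seq int) (a c : int) (m : nat) :
  uniq r -> c - a <= m%:Z -> (count (fun z => (a <= z < c)%R) r <= m)%N.
Proof.
move=> Ur le; rewrite -size_filter -(size_iota 0 m).
rewrite -(size_map (fun z : int => absz (z - a)%R)).
apply: uniq_leq_size.
  rewrite map_inj_in_uniq ?filter_uniq // => y z.
  rewrite !mem_filter => /andP[hy _] /andP[hz _]; lia.
move=> w /mapP[z]; rewrite mem_filter mem_iota => /andP[hz _] ->; lia.
Qed.

Section Words.
Variables (F : fieldType) (n : nat).
Implicit Types (e f : nat -> 'M[F]_n).

Definition word e f (x : nat -> nat) (k : nat) : 'M[F]_n :=
  \prod_(0 <= h < k) (if odd h then e (x h) else f (x h)).

Lemma wordS e f x k :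
  word e f x k.+1 = word e f x k *m (if odd k then e (x k) else f (x k)).
Proof. by rewrite /word big_nat_recr. Qed.

(** In [nat], [(i - k) + (k - i)] is the absolute difference. If B is the sum of the [t j *: f j]
    for orthogonal idempotents [f j] with sum 1, the left side is e_i B^s e_k. *)
Definition tridiagonal_rel e f (t : nat -> F) (d : nat) : Prop :=
  forall i k s, (s < (i - k) + (k - i))%N ->
    \sum_(0 <= j < d.+1) t j ^+ s *: (e i *m f j *m e k) = 0.

Section Signed.
Variables (e f : nat -> 'M[F]_n) (te tf : nat -> F) (de df : nat).
Hypothesis te_inj : {in [pred i | (i <= de)%N] &, injective te}.
Hypothesis tf_inj : {in [pred i | (i <= df)%N] &, injective tf}.
Hypothesis e_out : forall i, (de < i)%N -> e i = 0.
Hypothesis f_out : forall j, (df < j)%N -> f j = 0.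
Hypothesis rel_f : tridiagonal_rel e f tf df.
Hypothesis rel_e : tridiagonal_rel f e te de.

(** The boolean is the parity of the position, [true] selecting [e]. A code of the wrong sign stands
    for the letter 0, so words containing one vanish; [Z b] lists the codes of the genuine
    letters. *)
Let sgn (b : bool) (z : int) : int := if b then z else - z.
Let G (b : bool) (z : int) : 'M[F]_n :=
  if 0 <= sgn b z then (if b then e else f) `|z|%N else 0.
Let Z (b : bool) : seq int :=
  [seq sgn b j%:Z | j <- index_iota 0 (if b then de else df).+1].
Let t (b : bool) (z : int) : F := (if b then te else tf) `|z|%N.

Local Lemma Z_uniq b : uniq (Z b).
Proof.
by rewrite map_inj_uniq ?iota_uniq // => i j; rewrite /sgn; case: b; lia.
Qed.

Local Lemma G_notin b z : z \notin Z b -> G b z = 0.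
Proof.
move=> zZ; rewrite /G; case: ifP => // z0.
have lt : ((if b then de else df) < `|z|)%N.
  rewrite ltnNge; apply: contra zZ => zle; apply/mapP; exists `|z|%N.
    by rewrite mem_index_iota.
  by move: z0; rewrite /sgn; case: b {zle}; lia.
by case: b lt {z0 zZ} => lt; [apply: e_out|apply: f_out].
Qed.

Local Lemma t_inj b : {in Z b &, injective (t b)}.
Proof.
move=> _ _ /mapP[i ib ->] /mapP[j jb ->].
rewrite !mem_index_iota !ltnS /= in ib jb.
rewrite /t; have abs k : `|sgn b k%:Z|%N = k by rewrite /sgn; case: b {ib jb}; lia.
rewrite !abs; case: b ib jb {abs} => ib jb ee; congr (sgn _ _%:Z).
  exact: te_inj ee.
exact: tf_inj ee.
Qed.

Local Lemma G_rel b a c s : s%:Z < `|a - c| ->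
  \sum_(z <- Z (~~ b)) t (~~ b) z ^+ s *: (G b a *m G (~~ b) z *m G b c) = 0.
Proof.
move=> hs; have [a0|a0] := boolP (0 <= sgn b a); last first.
  rewrite big1 // => z _; have -> : G b a = 0 by rewrite /G (negbTE a0).
  by rewrite !mul0mx scaler0.
have [c0|c0] := boolP (0 <= sgn b c); last first.
  rewrite big1 // => z _; have -> : G b c = 0 by rewrite /G (negbTE c0).
  by rewrite !mulmx0 scaler0.
have hs' : (s < (`|a| - `|c|) + (`|c| - `|a|))%N.
  by move: a0 c0; rewrite /sgn; case: b; lia.
(* The dependent [if] treats both parities at once: [rel_f] between two letters [e], [rel_e] between
   two letters [f]. *)
have := if b return \sum_(0 <= j < (if ~~ b then de else df).+1)
   (if ~~ b then te else tf) j ^+ s *: ((if b then e else f) `|a|%N *m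
   (if ~~ b then e else f) j *m (if b then e else f) `|c|%N) = 0
   then rel_f hs' else rel_e hs'.
move=> rel0; rewrite /Z big_map -[RHS]rel0; apply: eq_big_nat => j _.
rewrite /t /G a0 c0.
have -> : `|sgn (~~ b) j%:Z|%N = j by rewrite /sgn; case: b {a0 c0 rel0} => /=; lia.
by have -> : 0 <= sgn (~~ b) (sgn (~~ b) j%:Z) by rewrite /sgn; case: b {a0 c0 rel0} => /=; lia.
Qed.

Let wordZ (N : nat) (y : nat -> int) : 'M[F]_n :=
  \prod_(0 <= h < N.+1) G (odd h) (y h).

Local Lemma wordZ0 N y h : (h <= N)%N -> G (odd h) (y h) = 0 -> wordZ N y = 0.
Proof.
move=> hN Gh; rewrite /wordZ (@big_cat_nat _ _ _ h) //=; last exact: leqW.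
by rewrite [X in _ * X]big_ltn // Gh mul0r mulr0.
Qed.

Local Lemma wordZ_upd N y m j : (m.+2 <= N)%N ->
  wordZ N (upd y m.+1 j) =
  \prod_(0 <= h < m) G (odd h) (y h) *m
  (G (odd m) (y m) *m G (~~ odd m) j *m G (odd m) (y m.+2)) *m
  \prod_(m.+3 <= h < N.+1) G (odd h) (y h).
Proof.
move=> mN; rewrite /wordZ (@big_cat_nat _ _ _ m) //=; last by lia.
rewrite [X in _ * X]big_ltn; last by lia.
rewrite [X in _ * (_ * X)]big_ltn; last by lia.
rewrite [X in _ * (_ * (_ * X))]big_ltn; last by lia.
rewrite -!mulmxE -!mulmxA; congr (_ *m _).
  by apply: eq_big_nat => h hm; rewrite /upd ltn_eqF //; lia.
rewrite /= negbK /upd eqxx ltn_eqF // gtn_eqF //; do 3 congr (_ *m _).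
by apply: eq_big_nat => h hm; rewrite gtn_eqF //; lia.
Qed.

(** [Q_closed_word] is applied to membership in [P]. The spirals that remain are f_0 e f_0 ... e
    f_0, which the closure rule builds from [f 0]. *)
Lemma corner_word (P : 'M[F]_n -> Prop) x k :
    lin_closed P -> P (f 0%N) -> (forall i M, P M -> P (M *m e i *m f 0%N)) ->
    ~~ odd k -> x 0%N = 0%N -> x k = 0%N ->
  P (word e f x k.+1).
Proof.
move=> hP Pf0 Pef ok x0 xk.
pose z h : int := if odd h then (x h)%:Z else - (x h)%:Z.
have -> : word e f x k.+1 = wordZ k z.
  apply: eq_big_nat => h _; rewrite /G /z /sgn; case: (odd h); first by rewrite absz_nat.
  by rewrite opprK abszN absz_nat.
have Q0 y h : (h <= k)%N -> G (odd h) (y h) = 0 -> P (wordZ k y).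
  by move=> hk Gh; rewrite (wordZ0 hk Gh); apply: hP.1.
apply: (@Q_closed_word k (de + df) (fun y => P (wordZ k y))) => //.
- move=> y y' yy' Py; suff <- : wordZ k y = wordZ k y' by [].
  by apply: eq_big_nat => h hk; rewrite yy'.
- move=> y h hk lt; apply: (Q0 _ h) => //; apply: G_notin.
  apply/mapP => -[j]; rewrite mem_index_iota /sgn; case: (odd h); lia.
- by move=> y h hk oh lt; apply: (Q0 _ h); rewrite // /G /sgn oh leNgt lt.
- move=> y h hk oh lt; apply: (Q0 _ h); rewrite // /G /sgn (negbTE oh).
  by rewrite oppr_ge0 leNgt lt.
- move=> y m a c mk hac hy; pose b := ~~ odd m.
  have [yZ|yZ] := boolP (y m.+1 \in Z b); last first.
    by apply: (Q0 _ m.+1); [exact: ltnW|apply: G_notin].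
  have -> : wordZ k y = wordZ k (upd y m.+1 (y m.+1)).
    apply: eq_big_nat => h _; rewrite /upd.
    by case: (eqVneq h m.+1) => [->|].
  (* With all other letters fixed, the word is linear in the letter at [m.+1] and inherits the
     relations [G_rel]. *)
  move: (y m.+1) yZ; apply: (@elimination _ _ P _ _ (t b) _
    (fun j => a <= j < c) (absz (y m - y m.+2)%R) hP (Z_uniq b) (@t_inj b)).
  + move=> s hs; under eq_bigr => j _ do
      rewrite wordZ_upd // scalemxAl scalemxAr.
    rewrite -mulmx_suml -mulmx_sumr G_rel ?mulmx0 ?mul0mx //; lia.
  + by apply: count_interval; [exact: Z_uniq|lia].
  + by move=> j _ nS; apply: hy; lia.
- move=> y hy; rewrite /wordZ.
  have y0 h : (h <= k)%N -> ~~ odd h -> G (odd h) (y h) = f 0%N.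
    by move=> hk oh; rewrite hy // (negbTE oh) /G.
  have : (k <= k)%N by [].
  rewrite -{1 3}(even_halfK ok); elim: (k./2) => [|l IHl] lk.
    by rewrite big_nat1 (y0 0%N).
  rewrite doubleS in lk *; rewrite big_nat_recr // big_nat_recr //= -!mulmxE.
  have P1 := IHl (ltnW (ltnW lk)).
  rewrite (y0 l.*2.+2) ?odd_double //; last by rewrite /= negbK odd_double.
  rewrite [G _ (y l.*2.+1)]/G /=; case: ifP => _; first exact: (Pef _ _ P1).
  by rewrite mulmx0 mul0mx; apply: hP.1.
- by rewrite /z /= x0.
- by rewrite /z (negbTE ok) xk.
Qed.

(** The difference [B i j k] is antisymmetric in [i] and [k]. It satisfies [j] Vandermonde relations
    in [k] and |i - k| of them in [j]; together these force it to vanish, and the case [j = 0] is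
    the claim. *)
Lemma corner_commute i k :
  f 0%N *m e i *m f 0%N *m e k *m f 0%N = f 0%N *m e k *m f 0%N *m e i *m f 0%N.
Proof.
pose Y i j k := f 0%N *m e i *m f j *m e k *m f 0%N.
pose B i j k := Y i j k - Y k j i.
have BC i1 j k1 : B i1 j k1 = - B k1 j i1 by rewrite opprB.
have rel1 i1 j s : (s < j)%N -> \sum_(k1 <- iota 0 de.+1) te k1 ^+ s *: B i1 j k1 = 0.
  move=> sj; have r1 : (s < (j - 0) + (0 - j))%N by rewrite subn0; lia.
  have r2 : (s < (0 - j) + (j - 0))%N by rewrite subn0; lia.
  rewrite -(subn0 de.+1) -/(index_iota 0 de.+1).
  transitivity (f 0%N *m e i1 *m
      \sum_(0 <= l < de.+1) te l ^+ s *: (f j *m e l *m f 0%N) -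
    (\sum_(0 <= l < de.+1) te l ^+ s *: (f 0%N *m e l *m f j)) *m e i1 *m f 0%N).
    rewrite mulmx_sumr !mulmx_suml -sumrB; apply: eq_bigr => l _.
    by rewrite /B /Y scalerBr -!scalemxAr -!scalemxAl !mulmxA.
  by rewrite rel_e // rel_e // mulmx0 !mul0mx subr0.
have rel2 i1 k1 s : (s < (i1 - k1) + (k1 - i1))%N ->
    \sum_(j <- iota 0 df.+1) tf j ^+ s *: B i1 j k1 = 0.
  move=> hs; have hs' : (s < (k1 - i1) + (i1 - k1))%N by rewrite addnC.
  rewrite -(subn0 df.+1) -/(index_iota 0 df.+1).
  transitivity (f 0%N *m (\sum_(0 <= l < df.+1) tf l ^+ s *: (e i1 *m f l *m e k1)
      - \sum_(0 <= l < df.+1) tf l ^+ s *: (e k1 *m f l *m e i1)) *m f 0%N).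
    rewrite -sumrB mulmx_sumr !mulmx_suml; apply: eq_bigr => l _.
    by rewrite /B /Y -scalerBr -!scalemxAr -!scalemxAl mulmxBr mulmxBl !mulmxA.
  by rewrite !rel_f // subrr mulmx0 mul0mx.
have eq0 := @eq0_lin_closed F 'M[F]_n.
(* Descending induction on [j], with [c] as fuel; beyond [df] the middle letter is 0. *)
suff B0 c : forall j, (df < j + c)%N -> forall i1 k1, B i1 j k1 = 0.
  by apply/subr0_eq/(B0 df.+1); rewrite addnC ltn_addr.
elim: c => [|c IHc] j jc.
  by rewrite addn0 in jc; move=> i1 k1; rewrite /B /Y (f_out jc) !mulmx0 !mul0mx subrr.
(* If |i - k| exceeds [j], there are enough relations in the middle letter to determine the [j + 1]
   entries up to [j] from the later ones, which vanish by induction. *)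
have far i1 k1 : (j < (i1 - k1) + (k1 - i1))%N -> B i1 j k1 = 0.
  move=> far; have [jd|jd] := leqP j df; last first.
    by rewrite /B /Y (f_out jd) !mulmx0 !mul0mx subrr.
  apply: (@elimination _ _ _ _ (iota 0 df.+1) tf _ (fun l => l <= j)%N _ eq0
    (iota_uniq _ _) _ (rel2 i1 k1)).
  - by move=> l l'; rewrite !mem_iota !add0n !ltnS; apply: tf_inj.
  - rewrite -size_filter; apply: leq_trans far; rewrite -(size_iota 0 j.+1).
    apply: uniq_leq_size; first by rewrite filter_uniq ?iota_uniq.
    by move=> l; rewrite mem_filter !mem_iota; lia.
  - by move=> l _; rewrite -ltnNge => jl; apply: IHc; lia.
  - by rewrite mem_iota add0n ltnS.
elim/ltn_ind => i1 IHi k1; have [kd|kd] := leqP k1 de; last first.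
  by rewrite /B /Y (e_out kd) !mulmx0 !mul0mx subrr.
(* For fixed [i1] the entries below [i1] vanish by antisymmetry and induction, the one at [i1]
   trivially, those above [i1 + j] by [far]. The [j] entries left are determined by [rel1]. *)
apply: (@elimination _ _ _ _ (iota 0 de.+1) te _ (fun l => i1 < l <= i1 + j)%N _ eq0
  (iota_uniq _ _) _ (rel1 i1 j)).
- by move=> l l'; rewrite !mem_iota !add0n !ltnS; apply: te_inj.
- rewrite -size_filter -[X in (_ <= X)%N](size_iota i1.+1 j).
  apply: uniq_leq_size; first by rewrite filter_uniq ?iota_uniq.
  by move=> l; rewrite mem_filter !mem_iota; lia.
- move=> l _ nS; have [lt|gt|->] := ltngtP l i1; last by rewrite /B subrr.
    by rewrite BC IHi ?oppr0.
  by apply: far; lia.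
- by rewrite mem_iota add0n ltnS.
Qed.

End Signed.
End Words.

(** * Right multiplication of words by algebra elements *)

Section Absorption.
Variables (F : fieldType) (n : nat) (e f : nat -> 'M[F]_n).

(** The span of the words beginning with f_0 is stable under right multiplication by [t].
    Quantifying over every linearly closed [P] spares the construction of this span. *)
Definition absorbed (t : 'M[F]_n) : Prop :=
  forall P : 'M[F]_n -> Prop, lin_closed P ->
  (forall x k, x 0%N = 0%N -> P (word e f x k.+1)) ->
  forall x k, x 0%N = 0%N -> P (word e f x k.+1 *m t).

Hypothesis ee : forall i j, e i *m e j = if i == j then e i else 0.
Hypothesis ff : forall i j, f i *m f j = if i == j then f i else 0.

Lemma absorbed_lin_closed : lin_closed absorbed.
Proof.
split=> [P hP _ x k _|a u v hu hv P hP Pw x k x0].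
  by rewrite mulmx0; apply: hP.1.
by rewrite mulmxDr -scalemxAr; apply: hP.2; [apply: hu|apply: hv].
Qed.

Lemma absorbedM t1 t2 : absorbed t1 -> absorbed t2 -> absorbed (t1 *m t2).
Proof.
move=> h1 h2 P hP Pw x k x0; rewrite mulmxA.
apply: (h1 (fun M => P (M *m t2))) => //; last by apply: h2.
split=> [|a u v Pu Pv]; first by rewrite mul0mx; apply: hP.1.
by rewrite mulmxDl -scalemxAl; apply: hP.2.
Qed.

(** A letter of the same family as the last one merges with it by orthogonality; any other letter
    prolongs the word. *)
Lemma absorbed_letter b i : absorbed (if b then e i else f i).
Proof.
move=> P hP Pw x k x0; have [bk|bk] := eqVneq b (odd k).
  rewrite wordS -mulmxA bk.
  have -> : (if odd k then e (x k) else f (x k)) *m (if odd k then e i else f i) =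
      if x k == i then (if odd k then e (x k) else f (x k)) else 0.
    by case: (odd k); rewrite ?ee ?ff.
  case: ifP => _; first by rewrite -wordS; apply: Pw.
  by rewrite mulmx0; apply: hP.1.
pose y h := if h == k.+1 then i else x h.
have -> : word e f x k.+1 *m (if b then e i else f i) = word e f y k.+2.
  rewrite [RHS]wordS /y eqxx /=; congr (_ *m _); last by case: b (odd k) bk => [] [].
  by apply: eq_big_nat => h /andP[_ hk]; rewrite ltn_eqF.
by apply: Pw.
Qed.

End Absorption.

(** By excluded middle, a subspace inside [P] either exhausts [P] or can be enlarged by one
    dimension, and the ambient dimension bounds the number of enlargements. *)
Lemma lin_closed_vspace (F : fieldType) (V : vectType F) (P : V -> Prop) :
  lin_closed P -> exists U : {vspace V}, forall v, v \in U <-> P v.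
Proof.
move=> hP.
suff /(_ (\dim {:V}).+1) [U UP [ge|Uall]] : forall k, exists2 U : {vspace V},
    forall v, v \in U -> P v & (k <= \dim U)%N \/ forall v, P v -> v \in U.
- by move: (leq_trans ge (dimvS (subvf U))); rewrite ltnn.
- by exists U => v; split; [apply: UP|apply: Uall].
elim=> [|k [U UP [ge|Uall]]]; last by exists U => //; right.
  exists 0%VS; last by left.
  by move=> v; rewrite memv0 => /eqP ->; apply: hP.1.
have [Uall|] := pselect (forall v, P v -> v \in U); first by exists U => //; right.
move/existsNP => [v /not_implyP[Pv /negP vU]].
exists (U + <[v]>)%VS.
  move=> _ /memv_addP[u uU [w /vlineP[a ->] ->]]; rewrite addrC.
  by apply: hP.2 => //; apply: UP.
left; rewrite (leq_ltn_trans ge) // (ltn_leqif (dimv_leqif_sup (addvSl _ _))).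
by apply: contra vU => /subvP; apply; apply: (subvP (addvSr _ _)); exact: memv_line.
Qed.

(** * Symmetric matrices *)

Section Symmetric.
Variables (R : realType) (n : nat).
Implicit Types (u v w : 'cV[R]_n) (S : 'M[R]_n).

Lemma trmx_mul_eq0 u : u^T *m u = 0 -> u = 0.
Proof.
move=> /matrixP /(_ 0 0); rewrite !mxE => /eqP.
under eq_bigr => i _ do rewrite mxE -expr2.
rewrite psumr_eq0 => [/allP h|i _]; last exact: sqr_ge0.
apply/matrixP => i j; rewrite mxE ord1; apply/eqP.
by rewrite -sqrf_eq0; apply: h; rewrite mem_index_enum.
Qed.

(** Over the complex numbers a commuting family has a common eigenvector. Symmetry makes its
    eigenvalues real, so its real or its imaginary part serves. *)
Lemma common_eigenvector_sym (U : {vspace 'cV[R]_n}) (Ss : seq 'M[R]_n) :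
    U != 0%VS -> {in Ss, forall S, S^T = S} ->
    {in Ss, forall S, forall u, u \in U -> S *m u \in U} ->
    {in Ss &, forall S S', forall u, u \in U -> S *m (S' *m u) = S' *m (S *m u)} ->
  exists2 u, u \in U /\ u != 0 & {in Ss, forall S, exists c, S *m u = c *: u}.
Proof.
move=> U0 symS stS comS; pose d := \dim U.
pose K : 'M[R]_(d, n) := \matrix_(i < d) ((vbasis U)`_i)^T.
have KU (a : 'rV_d) : (a *m K)^T \in U.
  rewrite mulmx_sum_row linear_sum /=; apply: memv_suml => i _.
  rewrite linearZ /= rowK trmxK memvZ // vbasis_mem //.
  by rewrite mem_nth // size_tuple.
have UK u : u \in U -> exists a : 'rV_d, u^T = a *m K.
  move=> /coord_vbasis uE; exists (\row_i coord (vbasis U) i u).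
  rewrite {1}uE mulmx_sum_row linear_sum /=; apply: eq_bigr => i _.
  by rewrite linearZ /= rowK mxE.
have freeK : row_free K.
  apply/inj_row_free => a aK0.
  have /freeP fr := basis_free (vbasisP U).
  apply/rowP => i; rewrite mxE; apply: (fr (fun i => a 0 i)).
  have := congr1 trmx aK0; rewrite mulmx_sum_row linear_sum /= trmx0 => h; rewrite -[RHS]h.
  by apply: eq_bigr => j _; rewrite linearZ /= rowK trmxK.
(* [M S] is the matrix of [S] on [U] in row coordinates with respect to the basis [K]. *)
pose M S := K *m S *m pinvmx K.
have MK : {in Ss, forall S, M S *m K = K *m S}.
  move=> S hS; rewrite /M mulmxKpV //; apply/row_subP => i.
  have iU : (row i K)^T \in U by rewrite rowE.
  have [a aE] := UK _ (stS _ hS _ iU).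
  apply/submxP; exists a; rewrite -aE trmx_mul trmxK symS // row_mul.
  by [].
clearbody M; have d0 : (0 < d)%N by rewrite lt0n dimv_eq0.
pose rc (B : 'M[R]_d) := map_mx (real_complex R) B.
have [|v v0 /allP vst] := @common_eigenvector R[i] d [seq rc (M B) | B <- Ss] d0.
  move=> _ _ /mapP[S hS ->] /mapP[S' hS' ->].
  rewrite /comm_mx /rc -!map_mxM; congr map_mx.
  apply: (row_free_inj freeK) => /=; rewrite -!mulmxA !MK // !mulmxA !MK //.
  apply/row_matrixP => i; rewrite -!mulmxA !row_mul.
  have iU : (row i K)^T \in U by rewrite rowE.
  apply: trmx_inj; rewrite !trmx_mul !symS //.
  by rewrite -!mulmxA comS.
pose a := map_mx (@complex.Re R) v; pose b := map_mx (@complex.Im R) v.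
pose u := (a *m K)^T; pose w := (b *m K)^T.
have eig : {in Ss, forall S, exists al be,
    S *m u = al *: u - be *: w /\ S *m w = be *: u + al *: w}.
  move=> S hS; have /vst : rc (M S) \in [seq rc (M B) | B <- Ss] by apply: map_f.
  case/sub_rVP => l vE; exists (complex.Re l), (complex.Im l).
  have aE : a *m M S = complex.Re l *: a - complex.Im l *: b.
    apply/rowP => i; have /rowP/(_ i)/(congr1 (@complex.Re R)) := vE.
    rewrite !mxE raddf_sum /= => h; transitivity (complex.Re (l * v 0 i)).
      rewrite -h; apply: eq_bigr => j _; rewrite !mxE.
      by case: (v 0 j) => x y /=; rewrite mulr0 subr0.
    by case: (l) (v 0 i) => x y [z t].
  have bE : b *m M S = complex.Im l *: a + complex.Re l *: b.
    apply/rowP => i; have /rowP/(_ i)/(congr1 (@complex.Im R)) := vE.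
    rewrite !mxE raddf_sum /= => h; transitivity (complex.Im (l * v 0 i)).
      rewrite -h; apply: eq_bigr => j _; rewrite !mxE.
      by case: (v 0 j) => x y /=; rewrite mulr0 add0r.
    by case: (l) (v 0 i) => x y [z t] /=; rewrite addrC.
  have trE (c : 'rV_d) : S *m (c *m K)^T = (c *m M S *m K)^T.
    by rewrite -mulmxA MK // mulmxA [RHS]trmx_mul symS.
  rewrite /u /w !trE aE bE !mulmxDl mulNmx -!scalemxAl.
  by rewrite !linearD /= !linearN /= !linearZ.
have uw0 : u^T *m u + w^T *m w != 0.
  apply: contra v0 => /eqP uw; have [u0 w0] : u = 0 /\ w = 0.
    have nn (z : 'cV[R]_n) : 0 <= (z^T *m z) 0 0.
      by rewrite mxE; apply: sumr_ge0 => i _; rewrite mxE -expr2 sqr_ge0.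
    have /matrixP/(_ 0 0) := uw; rewrite mxE [RHS]mxE => /eqP.
    rewrite paddr_eq0 // => /andP[/eqP uu /eqP ww].
    by split; apply: trmx_mul_eq0; apply/matrixP => i j; rewrite !ord1 [RHS]mxE.
  have aK : a = 0 by apply: (row_free_inj freeK); rewrite /= mul0mx -[LHS]trmxK -/u u0 trmx0.
  have bK : b = 0 by apply: (row_free_inj freeK); rewrite /= mul0mx -[LHS]trmxK -/w w0 trmx0.
  apply/eqP/rowP => i; have /rowP/(_ i) := aK; have /rowP/(_ i) := bK.
  by rewrite !mxE; case: (v 0 i) => x y /= -> ->.
have uU : u \in U := KU a.
have wU : w \in U := KU b.
clearbody u w.
have real_eig : {in Ss, forall S, exists c, S *m u = c *: u /\ S *m w = c *: w}.
  move=> S hS; have [al [be [Eu Ew]]] := eig S hS.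
  (* Comparing u^T S w with w^T S u gives be (u^T u + w^T w) = 0. *)
  suff be0 : be = 0.
    by exists al; rewrite Eu Ew be0 !scale0r subr0 add0r.
  have tr11 (z : 'M[R]_1) : z^T = z by apply/matrixP => i j; rewrite mxE !ord1.
  have : u^T *m (S *m w) = w^T *m (S *m u).
    by rewrite -[LHS]tr11 !trmx_mul trmxK symS // mulmxA.
  rewrite Eu Ew mulmxDr mulmxBr -!scalemxAr.
  have -> : u^T *m w = w^T *m u by rewrite -[LHS]tr11 trmx_mul trmxK.
  rewrite addrC => /addrI /eqP; rewrite -subr_eq0 opprK -scalerDr scaler_eq0.
  by rewrite (negbTE uw0) orbF => /eqP.
have [u0|u0] := eqVneq u 0; last by exists u => // S /real_eig[c []]; exists c.
exists w => [|S /real_eig[c []]]; last by exists c.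
by split=> //; apply: contra uw0 => /eqP ->; rewrite u0 !mulmx0 addr0.
Qed.

End Symmetric.

Lemma prod_shift_eigenvector (F : fieldType) (n : nat) (S : 'M[F]_n) (s : seq F)
    (a : F) (u : 'cV_n) : S *m u = a *: u ->
  (\prod_(b <- s) (S - b%:M)) *m u = (\prod_(b <- s) (a - b)) *: u.
Proof.
move=> Su; elim: s => [|b s IHs]; first by rewrite !big_nil mul1mx scale1r.
rewrite !big_cons -mulmxE -mulmxA IHs -scalemxAr mulmxBl Su mul_scalar_mx.
by rewrite -scalerBl scalerA mulrC.
Qed.

Section SymmetricSpectrum.
Variables (R : realType) (n : nat) (S : 'M[R]_n).
Hypothesis symS : S^T = S.

Let annih (s : seq R) : 'M[R]_n := \prod_(a <- s) (S - a%:M).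

Local Lemma annih_cons a s : annih (a :: s) = (S - a%:M) *m annih s.
Proof. by rewrite /annih big_cons. Qed.

Local Lemma annih_comm s : S *m annih s = annih s *m S.
Proof.
elim: s => [|a s IHs]; first by rewrite /annih big_nil mulmx1 mul1mx.
rewrite annih_cons -mulmxA -IHs !mulmxA; congr (_ *m _).
by rewrite mulmxBr mulmxBl scalar_mxC.
Qed.

Local Lemma annih_sym s : (annih s)^T = annih s.
Proof.
elim: s => [|a s IHs]; first by rewrite /annih big_nil trmx1.
rewrite annih_cons trmx_mul IHs linearB /= symS tr_scalar_mx.
by rewrite mulmxBr mulmxBl annih_comm scalar_mxC.
Qed.

Lemma orthogonal_eigenvectors a b (u w : 'cV_n) : a != b ->
  S *m u = a *: u -> S *m w = b *: w -> u^T *m w = 0.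
Proof.
move=> ab Su Sw; have : u^T *m (S *m w) = (S *m u)^T *m w.
  by rewrite trmx_mul symS mulmxA.
rewrite Su Sw -scalemxAr [(a *: u)^T]linearZ /= -scalemxAl => /eqP.
rewrite -subr_eq0 -scalerBl scaler_eq0 subr_eq0 eq_sym (negbTE ab) /=.
by move/eqP.
Qed.

(** The spectral theorem as an induction principle. Let M be the product of the [S - a%:M]. If its
    image were nonzero, it would contain an eigenvector u = M w; but M kills u, and M is symmetric,
    so u^T u = (M u)^T w = 0. *)
Lemma spectral_ind (s : seq R) (P : 'cV[R]_n -> Prop) :
    uniq s -> (forall a (u : 'cV_n), u != 0 -> S *m u = a *: u -> a \in s) ->
    lin_closed P -> (forall a u, a \in s -> S *m u = a *: u -> P u) ->
  forall v, P v.
Proof.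
move=> Us alls hP Peig v.
have annih0 : annih s *m v = 0.
  have [U UP] : exists U : {vspace 'cV[R]_n},
      forall u, u \in U <-> exists w, u = annih s *m w.
    apply: lin_closed_vspace; split=> [|a _ _ [w ->] [w' ->]].
      by exists 0; rewrite mulmx0.
    by exists (a *: w + w'); rewrite mulmxDr -scalemxAr.
  apply/eqP/negP => /negP av0.
  have [||S' S'S|S' S'' S'S S''S|u [uU u0] eig] :=
      @common_eigenvector_sym R n U [:: S].
  - apply: contra av0 => /eqP U0; rewrite -memv0 -U0; apply/UP; by exists v.
  - by move=> S'; rewrite inE => /eqP ->.
  - move: S'S; rewrite inE => /eqP -> u /UP[w ->]; apply/UP; exists (S *m w).
    by rewrite !mulmxA annih_comm.
  - by move: S'S S''S; rewrite !inE => /eqP -> /eqP ->.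
  have [a Su] := eig S (mem_head _ _).
  have as_ : a \in s := alls _ _ u0 Su.
  have /UP[w uE] := uU; apply/negP: u0; rewrite negbK; apply/eqP/trmx_mul_eq0.
  rewrite {2}uE mulmxA -[annih s]annih_sym -trmx_mul (prod_shift_eigenvector _ Su).
  rewrite (big_rem a) //= subrr mul0r scale0r linear0 mul0mx //.
elim: s Us {alls} Peig v annih0 => [|a s IHs] /= Us Peig v.
  by rewrite /annih big_nil mul1mx => ->; apply: hP.1.
case/andP: Us => as_ Us; rewrite annih_cons => /eqP.
set w := annih s *m v.
rewrite -mulmxA mulmxBl mul_scalar_mx subr_eq0 => /eqP Sw.
(* [w] is an eigenvector for [a] on which the shorter product acts as [c], so [v - c^-1 *: w] is
   killed by that product. *)
pose c := \prod_(b <- s) (a - b).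
have c0 : c != 0.
  rewrite /c prodf_seq_neq0; apply/allP => b bs /=.
  by rewrite subr_eq0; apply: contraNneq as_ => ->.
have -> : v = c^-1 *: w + (v - c^-1 *: w) by rewrite addrC subrK.
apply: lin_closedD => //.
  by apply: lin_closedZ => //; apply: Peig Sw; rewrite mem_head.
apply: IHs => // [b u bs|].
  by apply: Peig; rewrite inE bs orbT.
by rewrite mulmxBr -scalemxAr -/w (prod_shift_eigenvector _ Sw) scalerA mulVf // scale1r subrr.
Qed.

End SymmetricSpectrum.

Lemma eq_mulmx (R : pzRingType) m n (A B : 'M[R]_(m, n)) :
  (forall v : 'cV_n, A *m v = B *m v) -> A = B.
Proof.
move=> AB; apply/matrixP => i j; have /matrixP/(_ i 0) := AB (delta_mx j 0).
by rewrite -!colE !mxE.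
Qed.

(** * Distance-regular graphs *)

Section Distance.
Variables (X : finType) (e : rel X).
Hypothesis hG : distance_regular e.
Local Notation D := (diameter e).
Local Notation dist := (dist e).
Local Notation walk := (walk e).

Lemma walk0 y z : walk 0 y z = (y == z).
Proof.
apply/existsP/idP => [[p]|yz]; first by rewrite tuple0.
by exists [tuple].
Qed.

Lemma walkS m y z : walk m.+1 y z = [exists w, e y w && walk m w z].
Proof.
apply/existsP/existsP => [[p]|[w /andP[yw /existsP[p /andP[wp pz]]]]].
  case/tupleP: p => w p /= /andP[/andP[yw wp] pz].
  by exists w; rewrite yw; apply/existsP; exists p; rewrite wp.
by exists [tuple of w :: p]; rewrite /= yw wp.
Qed.

(** Connected vertices are joined by a path without repetitions, hence with fewer than [#|X|] edges,
    so [dist] never takes its junk value. *)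
Lemma walk_dist y z : walk (dist y z) y z.
Proof.
have hw : has (fun m => walk m y z) (iota 0 #|X|).
  have /connectP[p0 yp0 zE] := drg_connected hG y z.
  have [p [yp Up zE']] : exists p, [/\ path e y p, uniq (y :: p) & z = last y p].
    by case/shortenP: yp0 zE => p yp Up _ zE; exists p.
  apply/hasP; exists (size p).
    by rewrite mem_iota add0n; have := max_card (mem (y :: p)); rewrite (card_uniqP Up).
  by apply/existsP; exists (in_tuple p); rewrite /= yp zE' eqxx.
have lt : (dist y z < #|X|)%N by move: hw; rewrite has_find size_iota.
by have := nth_find 0%N hw; rewrite nth_iota.
Qed.

Lemma dist_le m y z : walk m y z -> (dist y z <= m)%N.
Proof.
move=> w; rewrite leqNgt; apply/negP => lt.
have := before_find 0%N lt; rewrite nth_iota ?add0n ?w //.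
apply: leq_trans lt _; rewrite -[X in (_ <= X)%N](size_iota 0); exact: find_size.
Qed.

Lemma walk_rcons m y w z : walk m y w -> e w z -> walk m.+1 y z.
Proof.
elim: m y => [|m IHm] y.
  rewrite walk0 => /eqP -> wz; rewrite walkS; apply/existsP; exists z.
  by rewrite wz walk0 eqxx.
rewrite walkS => /existsP[t /andP[yt tw]] wz; rewrite walkS.
by apply/existsP; exists t; rewrite yt IHm.
Qed.

Lemma walk_sym m y z : walk m y z -> walk m z y.
Proof.
elim: m y => [|m IHm] y; first by rewrite !walk0 eq_sym.
rewrite [walk _ y z]walkS => /existsP[t /andP[yt tw]].
by apply: walk_rcons (IHm _ tw) _; rewrite (drg_symmetric hG).
Qed.

Lemma dist_sym y z : dist y z = dist z y.
Proof.
by apply/eqP; rewrite eqn_leq !dist_le // walk_sym // walk_dist.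
Qed.

Lemma dist_edge y w z : e y w -> (dist y z <= (dist w z).+1)%N.
Proof.
move=> yw; apply: dist_le; rewrite walkS; apply/existsP; exists w.
by rewrite yw walk_dist.
Qed.

Lemma dist_step y z m : dist y z = m.+1 -> exists w, dist w z = m.
Proof.
move=> yz; have := walk_dist y z; rewrite yz walkS => /existsP[w /andP[yw wz]].
exists w; apply/eqP; rewrite eqn_leq dist_le //= -ltnS -yz; exact: dist_edge.
Qed.

Lemma dist_eq1 y w : (dist y w == 1%N) = e y w.
Proof.
apply/idP/idP => [/eqP d1|yw].
  have := walk_dist y w; rewrite d1 walkS => /existsP[t].
  by rewrite walk0 => /andP[yt /eqP <-].
rewrite eqn_leq dist_le ?lt0n; last first.
  by rewrite walkS; apply/existsP; exists w; rewrite yw walk0 eqxx.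
apply/negP => /eqP d0; have := walk_dist y w; rewrite d0 walk0 => /eqP yE.
by move: yw; rewrite yE (drg_irreflexive hG).
Qed.

Lemma dist_diameter y z : (dist y z <= D)%N.
Proof.
apply: leq_trans (leq_bigmax (F := fun y => \max_z dist y z) y).
exact: (leq_bigmax (F := dist y)).
Qed.

Lemma dist_onto (x : X) j : (j <= D)%N -> exists y z, dist y z = j.
Proof.
have X0 : (0 < #|X|)%N by apply/card_gt0P; exists x.
have [y yE] := @bigop.eq_bigmax X (fun y => \max_z dist y z) X0.
have [z zE] := @bigop.eq_bigmax X (dist y) X0.
move=> jD; have : dist y z = (j + (D - j))%N by rewrite subnKC // -zE -yE.
elim: (D - j)%N y {yE zE} => [|m IHm] y; first by rewrite addn0 => <-; exists y, z.
by rewrite addnS => /dist_step[w /IHm].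
Qed.

End Distance.

(** * The Bose-Mesner algebra and its primitive idempotents *)

Section Adjacency.
Variables (R : realType) (X : finType) (e : rel X).
Hypotheses (hG : distance_regular e) (hD : (0 < diameter e)%N).
Local Notation n := #|X|.
Local Notation D := (diameter e).
Local Notation A := (adjmx R e).
Local Notation dist := (dist e).
Local Notation d_ k l := (Defs.dist e (enum_val k) (enum_val l)).

Lemma adjmx_sym : A^T = A.
Proof. by apply/matrixP => k l; rewrite !mxE (drg_symmetric hG). Qed.

Lemma adjmx_exp_ge0 s k l : 0 <= (A ^+ s) k l.
Proof.
elim: s k => [|s IHs] k; first by rewrite expr0 mxE ler0n.
rewrite exprS -mulmxE mxE; apply: sumr_ge0 => j _.
by rewrite mulr_ge0 ?IHs // mxE ler0n.
Qed.

(** The entries of [A] are nonnegative, so contributions of different walks cannot cancel. *)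
Lemma adjmx_exp_neq0 s k l :
  ((A ^+ s) k l != 0) = walk e s (enum_val k) (enum_val l).
Proof.
elim: s k => [|s IHs] k.
  by rewrite expr0 mxE walk0 (inj_eq enum_val_inj) pnatr_eq0 eqb0 negbK.
rewrite exprS -mulmxE mxE walkS psumr_eq0 => [|j _]; last first.
  by rewrite mulr_ge0 ?adjmx_exp_ge0 // mxE ler0n.
rewrite -has_predC; apply/hasP/existsP => [[j _]|[w /andP[kw wl]]].
  rewrite /= mulf_eq0 negb_or IHs mxE pnatr_eq0 eqb0 negbK => h.
  by exists (enum_val j).
exists (enum_rank w); first by rewrite mem_index_enum.
rewrite /= mulf_eq0 negb_or IHs mxE pnatr_eq0 eqb0 negbK.
by rewrite enum_rankK kw.
Qed.

(** Membership in the Bose-Mesner algebra, as the span of the distance matrices. *)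
Definition dist_mx (M : 'M[R]_n) : Prop :=
  exists m : nat -> R, forall k l, M k l = m (d_ k l).

Lemma dist_mxP (M : 'M[R]_n) :
  (forall k l k' l', d_ k l = d_ k' l' -> M k l = M k' l') -> dist_mx M.
Proof.
move=> hM; exists (fun i => if [pick p : 'I_n * 'I_n | d_ p.1 p.2 == i] is Some p
  then M p.1 p.2 else 0) => k l.
case: pickP => [p /eqP /hM // |/(_ (k, l))]; by rewrite eqxx.
Qed.

Lemma dist_mx1 : dist_mx 1%:M.
Proof.
apply: dist_mxP => k l k' l' kl; rewrite !mxE.
have dist0 y z : (y == z) = (dist y z == 0%N).
  apply/idP/eqP => [yz|yz]; last by rewrite -(walk0 e) -yz walk_dist.
  by apply/eqP; rewrite -leqn0 dist_le ?walk0.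
by rewrite -!(inj_eq enum_val_inj) !dist0 kl.
Qed.

Lemma dist_mx_lin_closed : lin_closed dist_mx.
Proof.
split=> [|a M M' [m hm] [m' hm']]; first by exists (fun=> 0) => k l; rewrite mxE.
by exists (fun i => a * m i + m' i) => k l; rewrite !mxE hm hm'.
Qed.

(** Grouping the neighbours of [k] by their distance to [l] writes an entry of the product through
    the numbers p^h_{1,i}, which depend only on the distance h of [k] and [l]. *)
Lemma dist_mx_adj M : dist_mx M -> dist_mx (A *m M).
Proof.
case=> m hm; apply: dist_mxP.
have AM k l : (A *m M) k l = \sum_(i < D.+1) m i *
    #|[set w | (dist (enum_val k) w == 1%N) && (dist (enum_val l) w == i)]|%:R.
  rewrite mxE.
  transitivity (\sum_(w : X) (e (enum_val k) w)%:R * m (dist w (enum_val l))).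
    rewrite [RHS](reindex (@enum_val X X)) /=; last exact/onW_bij/enum_val_bij.
    by apply: eq_bigr => j _; rewrite mxE hm.
  under [RHS]eq_bigr => i _ do
    rewrite -sum1dep_card natr_sum mulr_sumr big_mkcond /=.
  rewrite exchange_big /=; apply: eq_bigr => w _.
  have wD : (dist (enum_val l) w < D.+1)%N by rewrite ltnS dist_diameter.
  rewrite (bigD1 (Ordinal wD)) //= eqxx andbT dist_eq1 // big1 ?addr0.
    by rewrite dist_sym //; case: ifP => _; rewrite ?mul1r ?mul0r ?mulr1.
  move=> i iw; case: andP => // -[_ /eqP wi].
  by case/negP: iw; apply/eqP/val_inj.
move=> k l k' l' kl; rewrite !AM; apply: eq_bigr => i _; congr (_ * _%:R).
have [|||p hp] := drg_regular hG (h := d_ k l) (i := 1) (j := i) => //.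
- exact: dist_diameter.
- by rewrite -ltnS.
by rewrite !hp.
Qed.

Variables (E : 'I_D.+1 -> 'M[R]_n) (theta : 'I_D.+1 -> R).
Hypothesis theta_inj : injective theta.
Hypothesis theta_eig :
  forall a, passmx.leigenvalue (mxend A) a <-> exists i, theta i = a.
Hypothesis E_proj :
  forall i, is_orthoproj (E i) (passmx.leigenspace (mxend A) (theta i)).

Lemma mem_leigenspace a (u : 'cV[R]_n) :
  u \in passmx.leigenspace (mxend A) a <-> A *m u = a *: u.
Proof.
rewrite memv_ker add_lfunE opp_lfunE scale_lfunE id_lfunE lfunE /= subr_eq0.
by split => /eqP.
Qed.

Lemma idempotent_eigenvector i j (u : 'cV_n) : A *m u = theta i *: u ->
  E j *m u = if i == j then u else 0.
Proof.
move=> Au; have [EU E0] := E_proj j; case: eqP => [<-|/eqP ij].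
  by have [+ _] := E_proj i; apply; apply/mem_leigenspace.
apply: E0 => w /mem_leigenspace Aw.
apply: (orthogonal_eigenvectors adjmx_sym _ Aw Au).
by rewrite (inj_eq theta_inj) eq_sym.
Qed.

Lemma eigenvector_ind (P : 'cV[R]_n -> Prop) :
  lin_closed P -> (forall i u, A *m u = theta i *: u -> P u) -> forall v, P v.
Proof.
move=> hP Peig; apply: (@spectral_ind _ _ _ adjmx_sym [seq theta i | i <- enum 'I_D.+1]) => //.
- by rewrite map_inj_uniq ?enum_uniq.
- move=> a u u0 Au.
  have /theta_eig[i <-] : passmx.leigenvalue (mxend A) a.
    apply: contra u0 => /eqP U0; rewrite -memv0 -U0; exact/mem_leigenspace.
  by apply: map_f; rewrite mem_enum.
- by move=> a u /mapP[i _ ->]; apply: Peig.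
Qed.

Lemma mulmx_eq_lin_closed (B C : 'M[R]_n) : lin_closed (fun v : 'cV_n => B *m v = C *m v).
Proof.
split=> [|a u w Bu Bw]; first by rewrite !mulmx0.
by rewrite !mulmxDr -!scalemxAr Bu Bw.
Qed.

Lemma idempotentM i j : E i *m E j = if i == j then E i else 0.
Proof.
apply: eq_mulmx; apply: (eigenvector_ind (mulmx_eq_lin_closed _ _)) => k u Au.
rewrite -mulmxA !(idempotent_eigenvector _ Au).
have [<-|kj] := eqVneq k j; last first.
  rewrite mulmx0; case: eqP => [ij|_]; last by rewrite mul0mx.
  by rewrite (idempotent_eigenvector _ Au) ij (negbTE kj).
rewrite (idempotent_eigenvector _ Au) [i == k]eq_sym.
case: eqP => [ki|_]; first by rewrite (idempotent_eigenvector _ Au) ki eqxx.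
by rewrite mul0mx.
Qed.

Lemma adjmx_exp_idempotents s : A ^+ s = \sum_i theta i ^+ s *: E i.
Proof.
apply: eq_mulmx; apply: (eigenvector_ind (mulmx_eq_lin_closed _ _)) => k u Au.
have -> : A ^+ s *m u = theta k ^+ s *: u.
  elim: s => [|s IHs]; first by rewrite !expr0 mul1mx scale1r.
  by rewrite exprS -mulmxE -mulmxA IHs -scalemxAr Au scalerA exprSr.
rewrite mulmx_suml (bigD1 k) //= -scalemxAl (idempotent_eigenvector _ Au) eqxx.
rewrite big1 ?addr0 // => i ik.
by rewrite -scalemxAl (idempotent_eigenvector _ Au) eq_sym (negbTE ik) scaler0.
Qed.

Lemma sum_idempotents : \sum_i E i = 1%:M.
Proof.
rewrite -[1%:M]/(A ^+ 0) adjmx_exp_idempotents.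
by apply: eq_bigr => i _; rewrite expr0 scale1r.
Qed.

Lemma idempotent_sym i : (E i)^T = E i.
Proof.
suff h (v : 'cV_n) : forall w : 'cV_n, (E i *m v)^T *m w = v^T *m (E i *m w).
  apply: eq_mulmx => w; apply: trmx_inj; apply: eq_mulmx => v.
  by rewrite h trmx_mul trmxK mulmxA.
apply: (eigenvector_ind (P := fun v => forall w, (E i *m v)^T *m w = v^T *m (E i *m w)) _ _ v).
  split=> [w|a u u' hu hu' w]; first by rewrite mulmx0 !linear0 !mul0mx.
  rewrite mulmxDr -scalemxAr !linearD /= !linearZ /= !mulmxDl -!scalemxAl.
  by rewrite hu hu'.
move=> k u Au; apply: eigenvector_ind.
  split=> [|a w w' hw hw']; first by rewrite !mulmx0.
  by rewrite !mulmxDr -!scalemxAr hw hw'.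
move=> l w Aw; rewrite (idempotent_eigenvector _ Au) (idempotent_eigenvector _ Aw).
have [kl|kl] := eqVneq k l; first by rewrite kl; case: eqP; rewrite ?linear0 ?mul0mx ?mulmx0.
have uw : u^T *m w = 0.
  by apply: (orthogonal_eigenvectors adjmx_sym _ Au Aw); rewrite (inj_eq theta_inj).
by case: eqP => _; case: eqP => _; rewrite ?linear0 ?mul0mx ?mulmx0.
Qed.

(** By Lagrange interpolation, E_i is a scalar multiple of the product of the A - theta_j over j
    other than i. *)
Lemma idempotent_adj_ind (P : 'M[R]_n -> Prop) i :
  lin_closed P -> P 1%:M -> (forall M, P M -> P (A *m M)) -> P (E i).
Proof.
move=> hP P1 PA.
pose s := [seq theta j | j <- enum 'I_D.+1 & j != i].
pose M := \prod_(a <- s) (A - a%:M); pose c := \prod_(a <- s) (theta i - a).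
have c0 : c != 0.
  rewrite /c prodf_seq_neq0; apply/allP => _ /mapP[j + ->].
  by rewrite mem_filter subr_eq0 (inj_eq theta_inj) eq_sym => /andP[].
have -> : E i = c^-1 *: M.
  apply: eq_mulmx; apply: (eigenvector_ind (mulmx_eq_lin_closed _ _)) => k u Au.
  rewrite -scalemxAl (prod_shift_eigenvector _ Au) (idempotent_eigenvector _ Au).
  case: eqP => [->|/eqP ki]; first by rewrite scalerA mulVf ?scale1r.
  rewrite (big_rem (theta k)) /= ?subrr ?mul0r ?scale0r ?scaler0 //.
  by apply: map_f; rewrite mem_filter ki mem_enum.
apply: lin_closedZ => //.
rewrite /M; elim: (s) => [|a s' IHs]; first by rewrite big_nil.
rewrite big_cons -mulmxE mulmxBl mul_scalar_mx -scaleNr addrC.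
by apply: hP.2 => //; apply: PA.
Qed.

Lemma idempotent_dist_mx i : dist_mx (E i).
Proof.
exact: (idempotent_adj_ind _ dist_mx_lin_closed dist_mx1 dist_mx_adj).
Qed.

End Adjacency.

(** Insert the sum of the [g j] before the last factor [B]: each [j] is either too far from [i] for
    the first [s] factors or too far from [k] for the last one. *)
Lemma tridiagonal_exp (F : pzRingType) (n m : nat) (g : 'I_m -> 'M[F]_n) (B : 'M[F]_n) :
    \sum_i g i = 1%:M -> (forall i j, i != j -> g i *m g j = 0) ->
    (forall i j : 'I_m, (1 < (i - j) + (j - i))%N -> g i *m B *m g j = 0) ->
  forall s (i k : 'I_m), (s < (i - k) + (k - i))%N -> g i *m B ^+ s *m g k = 0.
Proof.
move=> g1 g0 gB; elim=> [|s IHs] i k lt.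
  rewrite expr0 mulmx1 g0 //; apply: contraTneq lt => ->; lia.
rewrite exprSr -mulmxE -[B in _ *m (_ *m B)]mul1mx -g1 mulmx_suml !mulmx_sumr.
rewrite mulmx_suml big1 // => j _; have [le|gt] := leqP ((i - j) + (j - i)) s.
  by rewrite -!mulmxA [g j *m _]mulmxA gB ?mulmx0 //; lia.
by rewrite !mulmxA IHs // !mul0mx.
Qed.

(** * The dual adjacency matrix *)

Section Qpolynomial.
Variables (R : realType) (X : finType) (e : rel X).
Hypotheses (hG : distance_regular e) (hD : (0 < diameter e)%N).
Local Notation n := #|X|.
Local Notation D := (diameter e).
Local Notation A := (adjmx R e).
Local Notation d_ k l := (Defs.dist e (enum_val k) (enum_val l)).

Variables (E : 'I_D.+1 -> 'M[R]_n) (theta : 'I_D.+1 -> R).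
Hypothesis theta_inj : injective theta.
Hypothesis theta_eig :
  forall a, passmx.leigenvalue (mxend A) a <-> exists i, theta i = a.
Hypothesis E_proj :
  forall i, is_orthoproj (E i) (passmx.leigenspace (mxend A) (theta i)).
Variable q : 'I_D.+1 -> 'I_D.+1 -> 'I_D.+1 -> R.
Hypothesis q_krein : krein_parameters E q.
Hypothesis q_poly : forall h i j : 'I_D.+1,
  ([|| h > i + j, i > h + j | j > h + i]%N -> q h i j = 0) /\
  ([|| h == i + j :> nat, i == h + j :> nat | j == h + i :> nat]%N ->
   q h i j != 0).

Let i1 : 'I_D.+1 := inord 1.

Local Lemma i1E : i1 = 1%N :> nat.
Proof. by rewrite inordK // ltnS. Qed.

Lemma krein_entry i j k l :
  E i k l * E j k l = n%:R^-1 * \sum_h q h i j * E h k l.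
Proof.
have /matrixP/(_ k l) := q_krein i j; rewrite !mxE summxE => ->.
by congr (_ * _); apply: eq_bigr => h _; rewrite mxE.
Qed.

(** Some power of [A] is nonzero at this entry and is a combination of the idempotents. *)
Lemma idempotent_entry_neq0 k l : exists i, E i k l != 0.
Proof.
apply/existsP; apply: contraT; rewrite negb_exists => /forallP E0.
have : (A ^+ d_ k l) k l != 0 by rewrite adjmx_exp_neq0 // walk_dist.
rewrite (adjmx_exp_idempotents hG theta_inj theta_eig E_proj) summxE big1 ?eqxx // => i _.
by have := E0 i; rewrite negbK mxE => /eqP ->; rewrite mulr0.
Qed.

(* The Schur square of E_0 is a multiple of E_0, so E_0 takes only the values 0
   and c; and E_0 o E_i is a nonzero multiple of E_i, so 0 is not taken. *)
Lemma idempotent0_const k l :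
  E ord0 k l = n%:R^-1 * q ord0 ord0 ord0.
Proof.
have n0 : n%:R^-1 != 0 :> R.
  by rewrite invr_eq0 pnatr_eq0 -lt0n; apply: leq_ltn_trans (ltn_ord k).
have E0 i : E i k l * E ord0 k l = n%:R^-1 * q i i ord0 * E i k l.
  rewrite krein_entry (bigD1 i) //= big1 ?addr0 ?mulrA // => h hi.
  rewrite (q_poly h i ord0).1 ?mul0r //= addn0.
  by move: hi; rewrite -val_eqE /=; lia.
have E00 : E ord0 k l != 0.
  apply/eqP => z; have [i /negP] := idempotent_entry_neq0 k l; apply.
  have /esym/eqP := E0 i; rewrite z mulr0 !mulf_eq0 (negbTE n0) /=.
  have [_ qi] := q_poly i i ord0; rewrite (negbTE (qi _)) //.
  by rewrite addn0 eqxx.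
by apply: (mulIf E00); rewrite E0.
Qed.

(** The entrywise product of E_{i-1} and E_1 involves only E_h with h at most i, and E_i with
    nonzero coefficient; so the entries of E_1 determine those of all E_i recursively. *)
Lemma idempotent_separation k l k' l' :
  E i1 k l = E i1 k' l' -> forall i, E i k l = E i k' l'.
Proof.
move=> E1 i; have [m] := ubnP i; elim: m i => // m IHm i im.
case: (posnP i) => [i0|ipos].
  by have -> : i = ord0; [exact: val_inj|rewrite !idempotent0_const].
have jD : (i.-1 < D.+1)%N by rewrite (leq_ltn_trans (leq_pred _) (ltn_ord i)).
pose j := Ordinal jD.
have ij : i = (j + i1)%N :> nat by rewrite i1E addn1 /= prednK.
have := krein_entry j i1 k l; rewrite E1 IHm; last by rewrite /=; lia.
rewrite krein_entry => /mulfI; rewrite invr_eq0 pnatr_eq0 -lt0n.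
move=> /(_ (leq_ltn_trans (leq0n _) (ltn_ord k))).
rewrite (bigD1 i) // [RHS](bigD1 i) //=.
have [_ qi] := q_poly i j i1.
have rest : \sum_(h | h != i) q h j i1 * E h k l = \sum_(h | h != i) q h j i1 * E h k' l'.
  apply: eq_bigr => h hi; have [hlt|hge] := ltnP h i.
    by rewrite IHm // (leq_trans hlt).
  rewrite (q_poly h j i1).1 ?mul0r //.
  by move: hi; rewrite -val_eqE /= in ij *; lia.
rewrite rest => /addIr /mulfI -> //; apply: qi.
by rewrite ij eqxx.
Qed.

(** If [m1] agreed at distances j < l, every E_i and hence A^j would too; but A^j is nonzero at
    distance j and zero at distance l. *)
Lemma dual_eigenvalue_inj (m1 : nat -> R) :
  (forall k l, E i1 k l = m1 (d_ k l)) ->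
  {in [pred j | (j <= D)%N] &, injective m1}.
Proof.
move=> hm; suff lt j l : (j < l <= D)%N -> m1 j <> m1 l.
  move=> j l; rewrite !inE => jD lD jl; case: (ltngtP j l) => // c.
    by case: (lt j l); rewrite ?c.
  by case: (lt l j); rewrite ?c.
case/andP=> jl lD jlE; have [y0 _] : exists y z, Defs.dist e y z = 0%N.
  have x0 : X by have := hD; rewrite /diameter; case: (pickP X) => // X0; rewrite big_pred0.
  by apply: (dist_onto hG x0).
have [y [z yz]] := dist_onto hG y0 (ltnW (leq_trans jl lD)).
have [y' [z' yz']] := dist_onto hG y0 lD.
pose k := enum_rank y; pose k2 := enum_rank z.
pose k' := enum_rank y'; pose k2' := enum_rank z'.
have kl : d_ k k2 = j by rewrite !enum_rankK.
have kl' : d_ k' k2' = l by rewrite !enum_rankK.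
have sep := idempotent_separation (k := k) (l := k2) (k' := k') (l' := k2').
have : (A ^+ j) k k2 = (A ^+ j) k' k2'.
  rewrite !(adjmx_exp_idempotents hG theta_inj theta_eig E_proj) !summxE.
  by apply: eq_bigr => i _; rewrite !mxE sep // !hm kl kl'.
move/eqP; apply/negP; have : (A ^+ j) k k2 != 0.
  by rewrite adjmx_exp_neq0 // -{1}kl walk_dist.
have -> : (A ^+ j) k' k2' = 0.
  apply/eqP; rewrite -[_ == 0]negbK adjmx_exp_neq0 //; apply/negP => /(dist_le).
  by rewrite kl' leqNgt jl.
by [].
Qed.

Variable x : X.
Let xi := enum_rank x.

Definition dual_adjmx : 'M[R]_n := diag_mx (\row_k E i1 k xi).

(** The sum of the squared entries of the product [B] is a^T (E_i o E_j) a, where [a] is the column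
    of E_1 at [x]. Only the Krein parameter q^1_{ij} survives there, and it vanishes. *)
Lemma idempotent_dual_adjmx (i j : 'I_D.+1) : (1 < (i - j) + (j - i))%N ->
  E i *m dual_adjmx *m E j = 0.
Proof.
move=> ij; set B := E i *m _ *m _.
have Esym := idempotent_sym hG theta_inj theta_eig E_proj.
have EM := idempotentM hG theta_inj theta_eig E_proj.
pose a : 'cV[R]_n := col xi (E i1).
have Ea h : E h *m a = if h == i1 then a else 0.
  by rewrite /a colE mulmxA EM; case: eqP => [->|_]; rewrite ?mul0mx.
have trB : \tr (B *m B^T) = 0.
  rewrite /B !trmx_mul !Esym tr_diag_mx !mulmxA -(mulmxA _ (E j) (E j)) EM eqxx.
  rewrite mxtrace_mulC !mulmxA EM eqxx.
  transitivity ((a^T *m map2_mx *%R (E i) (E j) *m a) 0 0).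
    rewrite mxE /mxtrace; transitivity
      (\sum_k \sum_l a k 0 * (E i k l * E j k l) * a l 0).
      apply: eq_bigr => k _; rewrite mul_mx_diag !mxE mulr_suml.
      apply: eq_bigr => l _; rewrite mul_mx_diag !mxE.
      have /matrixP/(_ k l) := Esym j; rewrite mxE => ->.
      by ring.
    rewrite exchange_big; apply: eq_bigr => l _; rewrite [in RHS]mxE mulr_suml.
    by apply: eq_bigr => k _; rewrite !mxE.
  rewrite q_krein -scalemxAr -scalemxAl mulmx_sumr mulmx_suml.
  rewrite big1 ?scaler0 ?mxE // => h _; rewrite -scalemxAr -scalemxAl -mulmxA Ea.
  case: eqP => [->|_]; last by rewrite mulmx0 scaler0.
  by rewrite (q_poly i1 i j).1 ?scale0r // i1E; lia.
clearbody B; apply/matrixP => k l; rewrite [RHS]mxE.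
have BB k' : (B *m B^T) k' k' = \sum_l' B k' l' ^+ 2.
  by rewrite mxE; apply: eq_bigr => l' _; rewrite mxE expr2.
have /eqP := trB; rewrite /mxtrace psumr_eq0 => [/allP/(_ k)|k' _]; last first.
  by rewrite BB; apply: sumr_ge0 => l' _; rewrite sqr_ge0.
rewrite mem_index_enum BB => /(_ isT) /=.
rewrite psumr_eq0 => [/allP/(_ l)|l' _]; last by rewrite sqr_ge0.
by rewrite mem_index_enum sqrf_eq0 => /(_ isT) /eqP.
Qed.

End Qpolynomial.

(** * The dual primitive idempotents *)

Section DualIdempotents.
Variables (R : realType) (X : finType) (e : rel X).
Hypothesis hG : distance_regular e.
Local Notation n := #|X|.
Local Notation D := (diameter e).
Variable x : X.
Local Notation F_ j := (Estar R e x j).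

Lemma EstarM i j : F_ i *m F_ j = if i == j then F_ i else 0.
Proof.
rewrite /Estar mulmx_diag; apply/matrixP => k l.
case: eqP => [->|ij]; rewrite !mxE.
  by congr (_ *+ _); case: eqP; rewrite ?mulr1 ?mulr0.
case: eqP => [dk|_]; rewrite ?mul0r ?mul0rn //.
by case: eqP => [dk'|_]; rewrite ?mulr0 ?mul0rn //; case: ij; rewrite -dk -dk'.
Qed.

Lemma Estar_sym i : (F_ i)^T = F_ i.
Proof. exact: tr_diag_mx. Qed.

Lemma sum_Estar_scale (m : nat -> R) :
  \sum_(0 <= j < D.+1) m j *: F_ j = diag_mx (\row_k m (Defs.dist e x (enum_val k))).
Proof.
rewrite big_mkord; apply/matrixP => k l; rewrite summxE !mxE.
have dD : (Defs.dist e x (enum_val k) < D.+1)%N by rewrite ltnS dist_diameter.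
rewrite (bigD1 (Ordinal dD)) //= big1 => [|j jd]; rewrite !mxE.
  by rewrite eqxx addr0; case: eqP => _; rewrite ?mulr1n ?mulr1 ?mulr0n ?mulr0.
case: eqP => [jE|_]; last by rewrite mul0rn mulr0.
by case/negP: jd; apply/eqP/val_inj.
Qed.

Lemma sum_Estar : \sum_(0 <= j < D.+1) F_ j = 1%:M.
Proof.
have := sum_Estar_scale (fun=> 1); under eq_bigr do rewrite scale1r.
by move=> ->; apply/matrixP => k l; rewrite !mxE.
Qed.

(** By the triangle inequality, the distances of adjacent vertices to [x] differ by at most 1. *)
Lemma Estar_adjmx i j : (1 < (i - j) + (j - i))%N ->
  F_ i *m adjmx R e *m F_ j = 0.
Proof.
move=> ij; apply/matrixP => k l.
rewrite mul_mx_diag mxE mul_diag_mx !mxE.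
case: (eqVneq (Defs.dist e x (enum_val k)) i) => [ik|_]; last by rewrite !mul0r.
case: (eqVneq (Defs.dist e x (enum_val l)) j) => [jl|_]; last by rewrite mulr0.
case kl: (e _ _); last by rewrite mulr0 mul0r.
have lk : e (enum_val l) (enum_val k) by rewrite (drg_symmetric hG).
have := dist_edge hG x kl; have := dist_edge hG x lk.
by rewrite !(dist_sym hG _ x) ik jl; lia.
Qed.

Lemma diag_mx_exp (a : 'rV[R]_n) s : diag_mx a ^+ s = diag_mx (map_mx (fun y => y ^+ s) a).
Proof.
elim: s => [|s IHs].
  by rewrite expr0; apply/matrixP => k l; rewrite !mxE expr0.
rewrite exprS IHs -mulmxE mulmx_diag; congr diag_mx.
by apply/rowP => k; rewrite !mxE exprS.
Qed.

End DualIdempotents.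

(** Right multiplication by [Q] stands for restriction to [W], so that identities on [W] become
    matrix identities. *)
Lemma projection_mx (F : fieldType) (n : nat) (W : {vspace 'cV[F]_n}) :
  exists2 Q : 'M[F]_n, forall v : 'cV_n, Q *m v \in W &
    forall w, w \in W -> Q *m w = w.
Proof.
pose Q : 'M[F]_n := \matrix_(k, l) (projv W (delta_mx l 0 : 'cV_n)) k 0.
have QE (v : 'cV_n) : Q *m v = projv W v.
  have -> : v = \sum_l v l 0 *: delta_mx l 0.
    by rewrite [LHS]matrix_sum_delta; apply: eq_bigr => l _; rewrite big_ord1.
  rewrite mulmx_sumr linear_sum; apply: eq_bigr => l _.
  rewrite -scalemxAr linearZ -colE; congr (_ *: _).
  by apply/matrixP => k j; rewrite !mxE ord1.
by exists Q => [v|w wW]; rewrite QE ?memv_proj ?projv_id.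
Qed.

(** * Sharpness *)

Section Sharpness.
Variables (R : realType) (X : finType) (e : rel X).
Hypotheses (hG : distance_regular e) (hD : (0 < diameter e)%N).
Local Notation n := #|X|.
Local Notation D := (diameter e).
Local Notation A := (adjmx R e).
Variable x : X.
Local Notation F_ j := (Estar R e x j).
Variable W : {vspace 'cV[R]_n}.
Hypothesis hW : irreducible_Tmodule e x W.
Let r := endpoint e x W.

Lemma mem_Estar_img j (w : 'cV_n) : w \in W -> F_ j *m w \in Estar_img e x j W.
Proof. by move=> wW; apply/memv_imgP; exists w; rewrite ?lfunE. Qed.

Lemma Estar_imgP j u : u \in Estar_img e x j W ->
  exists2 w, w \in W & u = F_ j *m w.
Proof. by case/memv_imgP => w wW ->; exists w; rewrite // lfunE. Qed.

Lemma endpointP : (r <= D)%N /\ Estar_img e x r W != 0%VS.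
Proof.
have [_ W0 _] := hW.
have hs : has (fun i => Estar_img e x i W != 0%VS) (iota 0 D.+1).
  apply/negP => /negP nh; case/negP: W0; rewrite -subv0; apply/subvP => w wW.
  rewrite memv0 -[w]mul1mx -(sum_Estar R e x) mulmx_suml big_nat big1 // => j jD.
  apply/eqP; rewrite -memv0; have := hasPn nh j.
  rewrite mem_iota add0n jD negbK => /(_ isT) /eqP <-; exact: mem_Estar_img.
have := hs; rewrite has_find size_iota ltnS => rD; split=> //.
by have := nth_find 0%N hs; rewrite nth_iota ?add0n.
Qed.

Lemma before_endpoint j (w : 'cV_n) : (j < r)%N -> w \in W -> F_ j *m w = 0.
Proof.
move=> jr wW; apply/eqP; rewrite -memv0.
have := before_find 0%N jr; rewrite nth_iota ?add0n => [/negbFE /eqP <-|].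
  exact: mem_Estar_img.
exact: leq_trans jr (leqW endpointP.1).
Qed.

(** The submodule T u of [W] is nonzero, hence all of [W], and the hypothesis confines its image
    under E_r^* to the line of [u]. *)
Lemma sharp_of_corner u : u \in Estar_img e x r W -> u != 0 ->
  (forall t, terwilliger e x t -> exists c, F_ r *m (t *m u) = c *: u) ->
  sharp e x W.
Proof.
move=> uU u0 hu; have [tW _ irr] := hW; have [rD U0] := endpointP.
have uW : u \in W.
  by have [w wW ->] := Estar_imgP uU; apply: tW => //; exact: terwilliger_Estar.
have [V VP] : exists V : {vspace 'cV[R]_n},
    forall v, v \in V <-> exists2 t, terwilliger e x t & v = t *m u.
  apply: lin_closed_vspace; split=> [|a _ _ [t ht ->] [t' ht' ->]].
    exists (0 *: 1%:M); first exact/terwilliger_scale/terwilliger_1.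
    by rewrite scale0r mul0mx.
  exists (a *: t + t'); last by rewrite mulmxDl -scalemxAl.
  by apply: terwilliger_add => //; apply: terwilliger_scale.
have uV : u \in V by apply/VP; exists 1%:M; [exact: terwilliger_1|rewrite mul1mx].
have [||V0|VW] := irr V.
- move=> B hB _ /VP[t ht ->]; apply/VP; exists (B *m t); last by rewrite mulmxA.
  exact: terwilliger_mul.
- by apply/subvP => _ /VP[t ht ->]; apply: tW.
- by case/negP: u0; rewrite -memv0 -V0.
have Uu : (Estar_img e x r W <= <[u]>)%VS.
  apply/subvP => _ /Estar_imgP[w + ->]; rewrite -VW => /VP[t ht ->].
  by have [c ->] := hu t ht; rewrite memvZ ?memv_line.
apply/eqP; rewrite eqn_leq (leq_trans (dimvS Uu)) ?dim_vline ?leq_b1 //.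
by rewrite lt0n dimv_eq0.
Qed.

Variables (E : 'I_D.+1 -> 'M[R]_n) (hE : Qpolynomial_ordering E).

Lemma sharp_irreducible : sharp e x W.
Proof.
have [[theta [theta_inj theta_eig _] E_proj] [q q_krein q_poly]] := hE.
have [tW _ _] := hW; have [rD U0] := endpointP.
have EM := idempotentM hG theta_inj theta_eig E_proj.
have Eadj := adjmx_exp_idempotents hG theta_inj theta_eig E_proj.
have E1 := sum_idempotents hG theta_inj theta_eig E_proj.
have Esym := idempotent_sym hG theta_inj theta_eig E_proj.
have [m1 hm1] := idempotent_dist_mx hG hD theta_inj theta_eig E_proj (inord 1).
have m1_inj := dual_eigenvalue_inj hG hD theta_inj theta_eig E_proj q_krein q_poly hm1.
have ET i : terwilliger e x (E i).
  apply: (idempotent_adj_ind hG theta_inj theta_eig E_proj).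
  - split=> [|a B C hB hC].
      by rewrite -(scale0r 1%:M); apply/terwilliger_scale/terwilliger_1.
    by apply: terwilliger_add => //; apply: terwilliger_scale.
  - exact: terwilliger_1.
  - by move=> M; apply: terwilliger_mul; exact: terwilliger_adj.
have [Q QW Qid] := projection_mx W.
have QtQ t : terwilliger e x t -> Q *m t *m Q = t *m Q.
  by move=> ht; apply: eq_mulmx => v; rewrite -!mulmxA Qid // tW.
have FT j : (j <= D)%N -> terwilliger e x (F_ j) by exact: terwilliger_Estar.
(* Both families are restricted to [W] by [Q] and vanish outside their index ranges; [ff] is shifted
   so that [ff 0] belongs to the endpoint. *)
pose ee i := if (i <= D)%N then E (inord i) *m Q else 0.
pose ff j := if (j <= D - r)%N then F_ (r + j) *m Q else 0.
have mulQ t t' : terwilliger e x t' -> t *m Q *m (t' *m Q) = t *m t' *m Q.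
  by move=> ht'; rewrite -mulmxA (mulmxA Q) QtQ // mulmxA.
have eeM i j : ee i *m ee j = if i == j then ee i else 0.
  rewrite /ee; case: leqP => iD; last by rewrite mul0mx; case: eqP.
  case: leqP => jD; last by rewrite mulmx0; case: eqP => // ij; move: iD jD; rewrite ij; lia.
  by rewrite mulQ // EM -val_eqE /= !inordK ?ltnS //; case: eqP; rewrite ?mul0mx.
have ffM i j : ff i *m ff j = if i == j then ff i else 0.
  rewrite /ff; case: leqP => iD; last by rewrite mul0mx; case: eqP.
  case: leqP => jD; last by rewrite mulmx0; case: eqP => // ij; move: iD jD; rewrite ij; lia.
  rewrite mulQ ?EstarM ?eqn_add2l; last by apply: FT; lia.
  by case: eqP; rewrite ?mul0mx.
pose te i := theta (inord i); pose tf j := m1 (r + j)%N.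
have te_inj : {in [pred i | (i <= D)%N] &, injective te}.
  move=> i j; rewrite !inE => iD jD /theta_inj /(congr1 val) /=.
  by rewrite !inordK.
have tf_inj : {in [pred i | (i <= D - r)%N] &, injective tf}.
  move=> i j; rewrite !inE => iD jD /m1_inj; rewrite !inE.
  by move=> /(_ ltac:(lia) ltac:(lia)) /addnI.
have ee_out i : (D < i)%N -> ee i = 0 by move=> iD; rewrite /ee leqNgt iD.
have ff_out j : (D - r < j)%N -> ff j = 0 by move=> jD; rewrite /ff leqNgt jD.
have rel_f : tridiagonal_rel ee ff tf (D - r).
  move=> i k s lt; have [iD|iD] := leqP i D; last first.
    by rewrite big1 // => j _; rewrite (ee_out i) // !mul0mx scaler0.
  have [kD|kD] := leqP k D; last first.
    by rewrite big1 // => j _; rewrite (ee_out k) // mulmx0 scaler0.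
  have dualE : dual_adjmx E x ^+ s = \sum_(0 <= j < D.+1) m1 j ^+ s *: F_ j.
    rewrite (sum_Estar_scale e x (fun j => m1 j ^+ s)) diag_mx_exp; congr diag_mx.
    by apply/rowP => l; rewrite !mxE hm1 enum_rankK dist_sym.
  have E0 i' j' : i' != j' -> E i' *m E j' = 0 by rewrite EM => /negbTE ->.
  have tri : E (inord i) *m dual_adjmx E x ^+ s *m E (inord k) = 0.
    apply: (tridiagonal_exp E1 E0) => [i' j'|].
      exact: (idempotent_dual_adjmx hG hD theta_inj theta_eig E_proj q_krein q_poly).
    by rewrite !inordK.
  transitivity (E (inord i) *m dual_adjmx E x ^+ s *m E (inord k) *m Q); last first.
    by rewrite tri mul0mx.
  have rD1 : (r <= D.+1)%N := leqW rD.
  rewrite dualE [X in _ = _ *m X *m _ *m _](@big_cat_nat _ _ _ r) //=.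
  rewrite mulmxDr !mulmxDl mulmx_sumr !mulmx_suml [X in _ = X + _]big_nat.
  (* The blocks below the endpoint vanish on [W], which leaves the indices from [r] on. *)
  rewrite [X in _ = X + _]big1 ?add0r => [|j /andP[_ jr]]; last first.
    rewrite -scalemxAr -!scalemxAl -!mulmxA.
    suff -> : F_ j *m (E (inord k) *m Q) = 0 by rewrite mulmx0 scaler0.
    by apply: eq_mulmx => v; rewrite mul0mx -!mulmxA before_endpoint // tW.
  have shift (G : nat -> 'M[R]_n) :
      \sum_(r <= j < D.+1) G j = \sum_(0 <= j < (D - r).+1) G (j + r)%N.
    by rewrite -{1}(add0n r) big_addn subSn.
  rewrite shift mulmx_sumr !mulmx_suml; apply: eq_big_nat => j jD.
  rewrite -scalemxAr -!scalemxAl /tf addnC /ee /ff iD kD.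
  have -> : (j <= D - r)%N by [].
  rewrite mulQ; last by apply: FT; lia.
  by rewrite mulQ // addnC.
have rel_e : tridiagonal_rel ff ee te D.
  move=> i k s lt; have [iD|iD] := leqP i (D - r); last first.
    by rewrite big1 // => j _; rewrite (ff_out i) // !mul0mx scaler0.
  have [kD|kD] := leqP k (D - r); last first.
    by rewrite big1 // => j _; rewrite (ff_out k) // mulmx0 scaler0.
  have F1 : \sum_(j < D.+1) F_ j = 1%:M by rewrite -(sum_Estar R e x) big_mkord.
  have riD : (r + i < D.+1)%N by lia.
  have rkD : (r + k < D.+1)%N by lia.
  have tri : F_ (r + i) *m A ^+ s *m F_ (r + k) = 0.
    apply: (tridiagonal_exp F1 (B := A) _ _ (i := Ordinal riD) (k := Ordinal rkD)) => /=.
    - by move=> i' j' ij; rewrite EstarM (inj_eq val_inj) (negbTE ij).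
    - by move=> i' j' ij; apply: Estar_adjmx.
    - by lia.
  transitivity (F_ (r + i) *m A ^+ s *m F_ (r + k) *m Q); last by rewrite tri mul0mx.
  rewrite Eadj mulmx_sumr !mulmx_suml big_mkord; apply: eq_bigr => j _.
  rewrite -scalemxAr -!scalemxAl /te inord_val /ff /ee iD kD -ltnS ltn_ord inord_val.
  rewrite mulQ // mulQ //; apply: FT; lia.
have com := corner_commute te_inj tf_inj ee_out ff_out rel_f rel_e.
(* Without [Q] these matrices are visibly symmetric; on [W] they act as f_0 e_i f_0. *)
pose S i := F_ r *m E i *m F_ r.
have f0E : ff 0%N = F_ r *m Q by rewrite /ff leq0n addn0.
have ST i : terwilliger e x (S i).
  by apply: terwilliger_mul; [apply: terwilliger_mul|]; [exact: FT|exact: ET|exact: FT].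
have Sff (i : 'I_D.+1) : S i *m Q = ff 0%N *m ee i *m ff 0%N.
  rewrite f0E /ee -ltnS ltn_ord inord_val mulQ ?ET // mulQ //; exact: FT.
have eeE (i : 'I_D.+1) : E i *m Q = ee i by rewrite /ee -ltnS ltn_ord inord_val.
have ffE i : (r <= i <= D)%N -> F_ i *m Q = ff (i - r)%N.
  by case/andP=> ri iD; rewrite /ff subnKC // leq_sub2r.
clearbody ee ff.
have UW u : u \in Estar_img e x r W -> u \in W.
  by case/Estar_imgP => w wW ->; apply: tW => //; exact: FT.
have [||||u [uU u0] Su] := @common_eigenvector_sym R n (Estar_img e x r W)
    [seq S i | i <- enum 'I_D.+1].
- exact: U0.
- by move=> _ /mapP[i _ ->]; rewrite /S !trmx_mul Esym Estar_sym mulmxA.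
- move=> _ /mapP[i _ ->] u /UW uW; rewrite /S -!mulmxA.
  exact/mem_Estar_img/(tW _ (ET i))/(tW _ (FT r rD)).
- move=> _ _ /mapP[i _ ->] /mapP[j _ ->] u /UW uW.
  have SS i' j' : S i' *m (S j' *m u) =
      ff 0%N *m ee i' *m ff 0%N *m ee j' *m ff 0%N *m u.
    transitivity (S i' *m S j' *m Q *m u).
      by rewrite -mulmxA Qid // -mulmxA.
    rewrite -(mulQ _ _ _ (ST j')) !Sff.
    by rewrite -!mulmxA [ff 0%N *m (ff 0%N *m _)]mulmxA ffM eqxx.
  by rewrite !SS com.
have uW := UW u uU.
have Fu : F_ r *m u = u.
  by have [w _ ->] := Estar_imgP uU; rewrite mulmxA EstarM eqxx.
(* The first clause lets M e_i f_0 act on [u] through f_0 e_i f_0, of which [u] is an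
   eigenvector. *)
pose P (M : 'M[R]_n) := M *m ff 0%N = M /\ exists c, M *m u = c *: u.
have f0u : ff 0%N *m u = u by rewrite f0E -mulmxA Qid.
have hP : lin_closed P.
  split=> [|a M M' [Mf [c Mu]] [Mf' [c' Mu']]].
    by split; [rewrite mul0mx|exists 0; rewrite mul0mx scale0r].
  split; first by rewrite mulmxDl -scalemxAl Mf Mf'.
  by exists (a * c + c'); rewrite mulmxDl -scalemxAl Mu Mu' scalerA scalerDl.
have Pf0 : P (ff 0%N).
  by split; [rewrite ffM eqxx|exists 1; rewrite scale1r].
have Pef i M : P M -> P (M *m ee i *m ff 0%N).
  case=> Mf [c Mu]; split; first by rewrite -!mulmxA ffM eqxx.
  have [iD|iD] := leqP i D; last first.
    by exists 0; rewrite ee_out // mulmx0 !mul0mx scale0r.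
  have [ci Sui] := Su (S (inord i)) (map_f _ (mem_enum _ _)).
  exists (ci * c); rewrite -Mf -!mulmxA [ff 0%N *m (ee i *m _)]mulmxA.
  have -> : ff 0%N *m ee i *m (ff 0%N *m u) = S (inord i) *m u.
    rewrite mulmxA -[in RHS](Qid _ uW) mulmxA Sff inordK //.
  by rewrite Sui -scalemxAr Mu scalerA.
have closed := corner_word te_inj tf_inj ee_out ff_out rel_f rel_e hP Pf0 Pef.
(* After a last letter [e] the factor [ff 0] closes the word; a last letter [f] merges with it,
   giving 0 unless its index is 0. *)
have absf0 (y : nat -> nat) k : y 0%N = 0%N -> P (word ee ff y k.+1 *m ff 0%N).
  move=> y0; case ok: (odd k).
    pose y' h := if h == k.+1 then 0%N else y h.
    have -> : word ee ff y k.+1 *m ff 0%N = word ee ff y' k.+2.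
      rewrite [RHS]wordS /y' eqxx /= ok /=; congr (_ *m _).
      by apply: eq_big_nat => h /andP[_ hk]; rewrite ltn_eqF.
    by apply: closed; rewrite /= ?ok // /y' ?eqxx.
  rewrite wordS ok -mulmxA ffM; case: eqP => [yk|_]; last by rewrite mulmx0; apply: hP.1.
  by have := closed y k; rewrite wordS ok => /(_ isT y0 yk).
(* On [W], [A] is a combination of letters by its spectral decomposition, and E_i^* is one letter
   or, below the endpoint, 0. *)
have absA t : terwilliger e x t -> absorbed ee ff (t *m Q).
  have absE := absorbed_lin_closed ee ff.
  elim=> {t} [|i iD||B C _ hB _ hC|a B _ hB|B C _ hB hCT hC].
  - have -> : A = \sum_i theta i *: E i.
      by rewrite -[LHS]expr1 Eadj; apply: eq_bigr => i _; rewrite expr1.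
    rewrite mulmx_suml; apply: (lin_closed_sum absE) => i _ _.
    rewrite -scalemxAl; apply: (lin_closedZ absE).
    rewrite eeE; exact: (absorbed_letter eeM ffM true).
  - have [ir|ri] := ltnP i r.
      have -> : F_ i *m Q = 0.
        by apply: eq_mulmx => v; rewrite mul0mx -mulmxA before_endpoint.
      exact: absE.1.
    rewrite ffE ?ri //; exact: (absorbed_letter eeM ffM false).
  - rewrite -E1 mulmx_suml; apply: (lin_closed_sum absE) => i _ _.
    rewrite eeE; exact: (absorbed_letter eeM ffM true).
  - by rewrite mulmxDl; apply: (lin_closedD absE).
  - by rewrite -scalemxAl; apply: (lin_closedZ absE).
  - by rewrite -mulQ //; apply: absorbedM.
apply: (@sharp_of_corner u) => // t ht.
(* Absorbing [t] into the one-letter word [ff 0] and closing with [ff 0] shows that f_0 t f_0 sends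
   [u] to a multiple of itself. *)
have [|||_ [c cE]] := absA t ht (fun M => P (M *m ff 0%N)) _ _ (fun=> 0%N) 0%N.
- split=> [|a M M' hM hM']; first by rewrite mul0mx; apply: hP.1.
  by rewrite mulmxDl -scalemxAl; apply: hP.2.
- by move=> y k; apply: absf0.
- by [].
exists c; rewrite -cE /word big_nat1 /= f0E.
rewrite -!mulmxA (Qid u) // Fu (Qid u) //; congr (_ *m _).
by rewrite Qid //; apply: tW.
Qed.

End Sharpness.

Theorem theorem1p1 (R : realType) (X : finType) (e : rel X)
    (hG : distance_regular e) (hD : (3 <= diameter e)%N)
    (E : 'I_(diameter e).+1 -> 'M[R]_#|X|) (hE : Qpolynomial_ordering E)
    (x : X) (W : {vspace 'cV[R]_#|X|}) (hW : irreducible_Tmodule e x W) :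
  sharp e x W.
Proof. by apply: sharp_irreducible hE => //; apply: leq_trans hD. Qed.
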